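(* (a) If $[p_1^{n_1},\dots,p_k^{n_k}]$ is one of $[3^1,6^1,3^1,6^1]$, $[3^4,6^1]$, $[3^1,4^1,6^1,4^1]$, $[3^1,12^2]$, then there exists a semi-equivelar map $M$ of type $[p_1^{n_1},\dots,p_k^{n_k}]$ on the torus with exactly three ${\rm Aut}(M)$-orbits of vertices. (b) There exists a semi-equivelar map $N$ of type $[4^1,6^1,12^1]$ on the torus with exactly six ${\rm Aut}(N)$-orbits of vertices.
   Context: Maps. A map $M$ on a surface $S$ is a locally finite cell decomposition of $S$ into vertices, edges and faces. All maps are polyhedral: every face is an $n$-gon for some integer $n\ge 3$ (a closed disc bounded by a cycle of $n$ distinct vertices and $n$ edges), and the intersection of two distinct faces is empty, a single vertex, or a single edge. An automorphism of $M$ is a permutation of the vertex set which (together with its inverse) sends edges to edges and faces to faces; ${\rm Aut}(M)$ is the group of automorphisms of $M$. Type. For a vertex $u$ of $M$, the faces containing $u$ form a cycle $C_u$ (the face-cycle at $u$), consecutive faces sharing an edge through $u$. $M$ is semi-equivelar of type $[p_1^{n_1},\dots,p_k^{n_k}]$ (integers $p_i\ge 3$, $n_i\ge 1$, with $p_i\ne p_{i+1}$, indices modulo $k$, when $k>1$) if at every vertex $u$ the cycle $C_u$ consists, in cyclic order (in one of the two directions), of $n_1$ consecutive $p_1$-gons, then $n_2$ consecutive $p_2$-gons, ..., then $n_k$ consecutive $p_k$-gons. $M$ is semi-equivelar if it is semi-equivelar of some type. *)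

(* Defs.v *)
From HB Require Import structures.
From mathcomp Require Import all_boot all_order all_algebra.
From mathcomp Require Import all_classical all_reals all_analysis.
Set Implicit Arguments.
Unset Strict Implicit.
Unset Printing Implicit Defensive.
Import Order.TTheory GRing.Theory Num.Theory.
Import numFieldNormedType.Exports.
Local Open Scope classical_set_scope.
Local Open Scope ring_scope.

(* A surface is given as a subset S of an ambient Hausdorff space T, and the
   cells of a map on S are closed subsets of T contained in S. A continuous
   map into S is a continuous map into T with values in S, and a continuous
   injection of a closed interval or of a closed disc into T is
   automatically a homeomorphism onto its image (compact to Hausdorff). *)

Definition unit_disc (R : realType) : set (R * R) :=
  [set p | p.1 ^+ 2 + p.2 ^+ 2 <= 1].
Arguments unit_disc : clear implicits.

Definition unit_circle (R : realType) : set (R * R) :=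
  [set p | p.1 ^+ 2 + p.2 ^+ 2 = 1].
Arguments unit_circle : clear implicits.

Definition torus (R : realType) : set ((R * R) * (R * R)) :=
  unit_circle R `*` unit_circle R.
Arguments torus : clear implicits.

Definition is_arc (R : realType) (T : topologicalType) (a b : T) (e : set T) :
    Prop :=
  exists g : R -> T,
    [/\ {within `[0, 1], continuous g},
        set_bij `[0, 1] e g, g 0 = a & g 1 = b].

(* Edges and faces are closed cells. *)
Record cells (T : Type) := Cells {
  verts : set T;
  edges : set (set T);
  faces : set (set T)
}.

Definition all_cells (T : Type) (M : cells T) : set (set T) :=
  [set [set v] | v in verts M] `|` edges M `|` faces M.

Definition skeleton (T : Type) (M : cells T) : set T :=
  verts M `|` \bigcup_(e in edges M) e.

(* F is a closed disc, bounded by the cycle v_0 e_0 v_1 e_1 ... of n distinct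
   vertices and n edges, whose interior avoids the vertices and edges. The
   edges e_i are then distinct, since their pairs of ends are. *)
Definition ngon (R : realType) (T : topologicalType) (M : cells T)
    (n : nat) (F : set T) : Prop :=
  exists (f : R * R -> T) (v : nat -> T) (e : nat -> set T),
    [/\ {within unit_disc R, continuous f} /\ set_bij (unit_disc R) F f,
        [/\ (3 <= n)%N, {in `I_n &, injective v} &
            forall i, (i < n)%N -> verts M (v i)],
        forall i, (i < n)%N ->
          edges M (e i) /\ is_arc R (v i) (v (i.+1 %% n)%N) (e i),
        f @` unit_circle R = \bigcup_(i in `I_n) e i &
        F `&` skeleton M = f @` unit_circle R].

(* S is the disjoint union of the vertices, the open edges and the open
   faces: the remaining conditions for this are in ngon and polyhedral_map. *)
Definition edge_axiom (R : realType) (T : topologicalType) (M : cells T) :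
    Prop :=
  (forall e, edges M e -> exists a b, is_arc R a b e /\
     e `&` verts M = [set a; b]) /\
  (forall e e', edges M e -> edges M e' -> e <> e' -> e `&` e' `<=` verts M).

Definition locally_finite (T : topologicalType) (S : set T) (M : cells T) :
    Prop :=
  forall x, S x -> exists2 U, nbhs x U &
    finite_set [set c | all_cells M c /\ c `&` U !=set0].

Definition polyhedral_map (R : realType) (T : topologicalType) (S : set T)
    (M : cells T) : Prop :=
  [/\ \bigcup_(c in all_cells M) c = S,
      locally_finite S M,
      edge_axiom R M,
      (forall F, faces M F -> exists n, ngon R M n F) &
      forall F G, faces M F -> faces M G -> F <> G ->
        [\/ F `&` G = set0,
            exists2 v, verts M v & F `&` G = [set v] |
            edges M (F `&` G)]].

(* [p_1^n_1, ..., p_k^n_k] is encoded as [:: (p_1, n_1); ...; (p_k, n_k)]. *)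
Definition wf_type (t : seq (nat * nat)) : bool :=
  [&& (0 < size t)%N,
      all (fun x => (3 <= x.1)%N && (1 <= x.2)%N) t &
      (1 < size t)%N ==> path.cycle (fun x y => x.1 != y.1) t].

Definition face_sizes (t : seq (nat * nat)) : seq nat :=
  flatten [seq nseq x.2 x.1 | x <- t].

(* F_0, ..., F_(d-1) is the face-cycle at u. The listing may start at any face
   and run in either direction. *)
Definition face_cycle (T : Type) (M : cells T) (u : T) (d : nat)
    (F : nat -> set T) : Prop :=
  set_bij `I_d [set G | faces M G /\ G u] F /\
  forall i, (i < d)%N ->
    exists2 e, edges M e & e u /\ e `<=` F i `&` F (i.+1 %% d)%N.

Definition semi_equivelar (R : realType) (T : topologicalType) (M : cells T)
    (t : seq (nat * nat)) : Prop :=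
  wf_type t /\
  forall u, verts M u -> exists F : nat -> set T,
    face_cycle M u (size (face_sizes t)) F /\
    forall i, (i < size (face_sizes t))%N ->
      ngon R M (nth 0%N (face_sizes t) i) (F i).

(* The cells of a polyhedral map are determined by their sets of vertices, so
   a permutation of the vertices acts on edges and faces through these sets.
   A permutation which preserves edges and vertex sets of faces maps the
   boundary cycle of a face to a boundary cycle, because an edge with both ends
   on a face is an edge of that face. Only the values of phi on verts M
   matter; the equivalences cover both phi and its inverse. *)
Definition automorphism (T : Type) (M : cells T) (phi : T -> T) : Prop :=
  [/\ set_bij (verts M) (verts M) phi,
      forall A, A `<=` verts M ->
        [set e `&` verts M | e in edges M] A <->
        [set e `&` verts M | e in edges M] (phi @` A) &
      forall A, A `<=` verts M ->
        [set F `&` verts M | F in faces M] A <->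
        [set F `&` verts M | F in faces M] (phi @` A)].

Definition vertex_orbits (T : Type) (M : cells T) : set (set T) :=
  [set [set phi u | phi in automorphism M] | u in verts M].

(* Main.v *)
(* All five tilings are drawn on the triangular lattice Z^2, with the unit steps
   +-(1,0), +-(0,1), +-(1,1): the vertices are lattice points, the edges are
   unit segments, and every face is a hexagon, possibly degenerate,
   {x0 <= x <= x1, y0 <= y <= y1, z0 <= x - y <= z1}, some of whose vertices may
   be flat. The torus is R^2 / <(N,0), (c,M)>, embedded by sines and cosines.

   The lines x in Z, y in Z, x - y in Z cut the plane into open points, segments
   and triangles, each given by an integer label; every cell of the map is a
   union of them, so all set-theoretic requirements become finite checks on
   labels modulo the lattice. What is left is topology: faces are discs by
   radial rescaling between two gauges (positively homogeneous functions).

   Translations and the point reflections act on the map. The vertices they do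
   not identify are told apart by the number of vertices reached by walks that
   move, at the i-th step, inside the intersection of a k_i-gon and an l_i-gon;
   the periods (N,0), (c,M) are chosen so that these numbers differ. *)
Require Import Defs.
From HB Require Import structures.
From mathcomp Require Import all_boot all_order all_algebra.
From mathcomp Require Import all_classical all_reals all_analysis.
From mathcomp Require Import ring lra zify.
Set Implicit Arguments.
Unset Strict Implicit.
Unset Printing Implicit Defensive.
Import Order.TTheory GRing.Theory Num.Theory.
Import numFieldNormedType.Exports.
Local Open Scope classical_set_scope.
Local Open Scope ring_scope.

(** * The circle and the torus *)

Definition circ (R : realType) (x : R) : R * R :=
  (cos (2 * pi * x), sin (2 * pi * x)).

Lemma circ_unit_circle (R : realType) (x : R) : unit_circle R (circ x).
Proof. exact: cos2Dsin2. Qed.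

Lemma circDint (R : realType) (x : R) (k : int) : circ (x + k%:~R) = circ x.
Proof.
have Dnat (y : R) (n : nat) : circ (y + n%:R) = circ y.
  have -> : circ (y + n%:R) =
      (cos (2 * pi * y + pi *+ 2 *+ n), sin (2 * pi * y + pi *+ 2 *+ n)).
    by rewrite /circ -mulrnA -!(mulr_natr pi) natrM;
       congr (cos _, sin _); ring.
  by rewrite (periodicn (@cosD2pi R)) (periodicn (@sinD2pi R)).
case: k => n; first exact: Dnat.
by rewrite -(Dnat _ n.+1) NegzE mulrNz subrK.
Qed.

(** [cos] is injective on [[0, pi]]. An angle beyond [pi] is replaced by its complement to a full
    turn, which lies in that interval and would have to be [0]. *)
Lemma cos_eq1 (R : realType) (f : R) :
  0 <= f < 1 -> cos (2 * pi * f) = 1 -> f = 0.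
Proof.
move=> /andP[f0 f1] cf; have pi0 := pi_gt0 R.
have [le|gt] := leP (2 * pi * f) pi.
  have : 2 * pi * f = 0.
    apply: (@cos_inj R); rewrite ?in_itv /= ?lexx ?cos0 //; apply/andP; split;
      nra.
  by move/eqP; rewrite mulf_eq0 => /orP[/eqP|/eqP//]; lra.
have : pi *+ 2 - 2 * pi * f = 0.
  apply: (@cos_inj R); rewrite ?in_itv /= ?lexx ?cos0 //.
  - by apply/andP; split; rewrite -mulr_natr; nra.
  - by rewrite ltW.
  - by rewrite -cosN opprB -(cosD2pi (_ - _)) subrK.
by rewrite -mulr_natr; nra.
Qed.

(** The subtraction formula gives cosine 1 at [2 * pi * (x - y)]; by [cos_eq1] the fractional part
    of [x - y] vanishes. *)
Lemma circ_eq (R : realType) (x y : R) :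
  circ x = circ y <-> exists k : int, x = y + k%:~R.
Proof.
split=> [[cxy sxy]|[k ->]]; last exact: circDint.
have c1 : cos (2 * pi * (x - y)) = 1.
  by rewrite mulrBr cosB cxy sxy -!expr2 cos2Dsin2.
exists (Num.floor (x - y)).
set k := Num.floor _.
have xyE : x - y = (x - y - k%:~R) + k%:~R by ring.
have f0 : x - y - k%:~R = 0.
  apply: cos_eq1.
    have := floor_itv (x - y); rewrite -/k => /andP[]; rewrite intrD.
    by move=> *; apply/andP; split; lra.
  by have [<- _] := circDint (x - y - k%:~R) k; rewrite -xyE.
lra.
Qed.

(** [acos] finds the angle up to sign, and the sign of the second coordinate decides which. *)
Lemma circ_surj (R : realType) (p : R * R) :
  unit_circle R p -> exists x, circ x = p.
Proof.
case: p => a b; rewrite /unit_circle /= => ab1; have pi0 := pi_gt0 R.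
have [d dE] : exists d : R, cos d = a /\ sin d = b.
  have a1 : -1 <= a <= 1 by have b2 := sqr_ge0 b; apply/andP; split; nra.
  have sE : sin (acos a) = `|b|.
    by rewrite sin_acos // -sqrtr_sqr; congr Num.sqrt; lra.
  have [b0|b0] := leP 0 b.
    by exists (acos a); rewrite acosK ?in_itv // sE ger0_norm.
  by exists (- acos a); rewrite cosN sinN acosK ?in_itv // sE ltr0_norm ?opprK.
exists (d / (2 * pi)); rewrite /circ.
have -> : 2 * pi * (d / (2 * pi)) = d by field; rewrite gt_eqF //; lra.
by case: dE => -> ->.
Qed.

Lemma continuous_pair (T U V : topologicalType) (f : T -> U) (g : T -> V) :
  continuous f -> continuous g -> continuous (fun t => (f t, g t)).
Proof. by move=> cf cg x; exact: (cvg_pair (cf x) (cg x)). Qed.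

Lemma continuous_fst (T U : topologicalType) : continuous (@fst T U).
Proof. by move=> x; exact: cvg_fst. Qed.

Lemma continuous_snd (T U : topologicalType) : continuous (@snd T U).
Proof. by move=> x; exact: cvg_snd. Qed.

Lemma continuous_circ (R : realType) : continuous (@circ R).
Proof.
have c1 : continuous ( *%R (2 * pi : R)) by move=> x; exact: mulrl_continuous.
apply: continuous_pair => x.
  exact: (continuous_comp (c1 x) (@continuous_cos R _)).
exact: (continuous_comp (c1 x) (@continuous_sin R _)).
Qed.

Lemma continuous_lin (R : realType) (a b d : R) :
  continuous (fun p : R * R => a * p.1 + b * p.2 + d).
Proof.
move=> p; apply: (@cvgD _ R^o); last exact: cvg_cst.
apply: (@cvgD _ R^o).
  exact: (continuous_comp (@continuous_fst _ _ p) (@mulrl_continuous _ a _)).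
exact: (continuous_comp (@continuous_snd _ _ p) (@mulrl_continuous _ b _)).
Qed.

(** * Gauges and discs *)

Definition norm1 (R : realType) (v : R * R) : R := `|v.1| + `|v.2|.

(** The lower bound makes the origin the only zero. The two bounds together keep the quotient of two
    gauges bounded, on which continuity of [radial] at the origin rests. *)
Definition gauge (R : realType) (g : R * R -> R) : Prop :=
  [/\ continuous g,
      forall t v, 0 <= t -> g (t * v.1, t * v.2) = t * g v,
      exists2 k, 0 < k & forall v, k * norm1 v <= g v &
      exists K, forall v, g v <= K * norm1 v].

(** Each ray is rescaled so that level sets of [g1] go to level sets of [g2]. For gauges the factor
    at the origin is [0 / 0 = 0], and the origin is fixed. *)
Definition radial (R : realType) (g1 g2 : R * R -> R) (v : R * R) : R * R :=
  (g1 v / g2 v * v.1, g1 v / g2 v * v.2).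

Section Gauge.
Variable R : realType.
Implicit Types (g : R * R -> R) (v : R * R).

Lemma norm1_ge0 v : 0 <= norm1 v.
Proof. by rewrite addr_ge0. Qed.

Lemma norm1_eq0 v : norm1 v = 0 -> v = (0, 0).
Proof.
case: v => a b; rewrite /norm1 /= => /eqP.
by rewrite paddr_eq0 // !normr_eq0 => /andP[/eqP-> /eqP->].
Qed.

Lemma continuous_norm1 : continuous (@norm1 R).
Proof.
move=> v; apply: (@cvgD _ R^o); apply: cvg_norm.
  exact: continuous_fst.
exact: continuous_snd.
Qed.

Lemma gauge0 g : gauge g -> g (0, 0) = 0.
Proof. by move=> [_ gZ _ _]; have := gZ 0 (0, 0) (lexx _); rewrite !mul0r. Qed.

Lemma gauge_ge0 g v : gauge g -> 0 <= g v.
Proof.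
move=> [_ _ [k k0 gk] _]; apply: le_trans (gk v).
by rewrite mulr_ge0 ?norm1_ge0 ?ltW.
Qed.

Lemma gauge_eq0 g v : gauge g -> g v = 0 -> v = (0, 0).
Proof.
move=> [_ _ [k k0 gk] _] gv0; apply/norm1_eq0/eqP.
by have := gk v; rewrite gv0 pmulr_rle0 // eq_le norm1_ge0 andbT.
Qed.

Lemma gauge_radial g1 g2 v : gauge g1 -> gauge g2 -> g2 (radial g1 g2 v) = g1 v.
Proof.
move=> G1 G2; have [_ gZ _ _] := G2; rewrite gZ; last first.
  by rewrite divr_ge0 ?gauge_ge0.
have [g20|g20] := eqVneq (g2 v) 0; last by rewrite divfK.
by rewrite g20 mulr0 (gauge_eq0 G2 g20) gauge0.
Qed.

Lemma radialK g1 g2 :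
  gauge g1 -> gauge g2 -> cancel (radial g1 g2) (radial g2 g1).
Proof.
move=> G1 G2 v; rewrite {1}/radial gauge_radial //.
have [v0|v0] := eqVneq v (0, 0).
  by rewrite v0 /radial /= !mulr0.
have g10 : g1 v != 0 by apply: contra_neq v0 => /(gauge_eq0 G1).
have g20 : g2 v != 0 by apply: contra_neq v0 => /(gauge_eq0 G2).
have -> : g1 (radial g1 g2 v) = g1 v / g2 v * g1 v.
  by have [_ -> //] := G1; rewrite divr_ge0 ?gauge_ge0.
by case: v v0 g10 g20 => a b /= _ g10 g20; congr pair; field; rewrite g10 g20.
Qed.

(** Away from the origin the denominator is nonzero. At the origin the factor [g1 / g2] stays
    bounded, so both coordinates are squeezed by a multiple of [norm1]. *)
Lemma continuous_radial g1 g2 :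
  gauge g1 -> gauge g2 -> continuous (radial g1 g2).
Proof.
move=> G1 G2 v; have [c1 _ _ [K gK]] := G1; have [c2 _ [k k0 gk] _] := G2.
have [v0|v0] := eqVneq v (0, 0); last first.
  have g20 : g2 v != 0 by apply: contra_neq v0 => /(gauge_eq0 G2).
  have cq : g1 u / g2 u @[u --> v] --> g1 v / g2 v.
    by apply: cvgM; [exact: c1|apply: cvgV => //; exact: c2].
  apply: (@cvg_pair _ _ _ _ (nbhs _) (nbhs _)).
    by apply: cvgM => //; exact: continuous_fst.
  by apply: cvgM => //; exact: continuous_snd.
have qK u : `|g1 u / g2 u| <= `|K / k|.
  rewrite ger0_norm ?divr_ge0 ?gauge_ge0 //.
  have [u0|u0] := eqVneq (g2 u) 0; first by rewrite u0 invr0 mulr0.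
  apply: le_trans (ler_norm _).
  have g20 : 0 < g2 u by rewrite lt_neqAle eq_sym u0 gauge_ge0.
  rewrite ler_pdivrMr // mulrAC ler_pdivlMr //.
  have [K0|K0] := leP 0 K.
    rewrite (le_trans (ler_wpM2r (ltW k0) (gK u))) //.
    by rewrite -mulrA ler_wpM2l // mulrC.
  (* For negative [K], the bound [g1 u <= K * norm1 u] forces [norm1 u] to vanish, against
     [g2 u != 0]. *)
  have : norm1 u = 0.
    apply/eqP; rewrite eq_le norm1_ge0 andbT -(nmulr_rge0 _ K0).
    by rewrite (le_trans (gauge_ge0 _ G1) (gK u)).
  by move/norm1_eq0 => uE; rewrite uE gauge0 // eqxx in u0.
have small (f : R * R -> R) : (forall u, `|f u| <= norm1 u) ->
    g1 u / g2 u * f u @[u --> v] --> (0 : R).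
  move=> fn; apply: norm_cvg0.
  apply: (@squeeze_cvgr _ _ _ _ (cst 0) (fun u => `|K / k| * norm1 u)).
  - near=> u; rewrite normr_ge0 normrM.
    by rewrite ler_pM.
  - exact: cvg_cst.
  - have -> : (0 : R) = `|K / k| * norm1 v.
      by rewrite v0 /norm1 /= !normr0 addr0 mulr0.
    exact: (continuous_comp (@continuous_norm1 v) (@mulrl_continuous _ _ _)).
have r0 : radial g1 g2 v = (0, 0) by rewrite v0 /radial /= !mulr0.
rewrite /continuous_at r0.
apply: (@cvg_pair _ _ _ _ (nbhs _) (nbhs _)); apply: small => u.
  by rewrite lerDl.
by rewrite lerDr.
Unshelve. all: by end_near.
Qed.

Lemma radial_bij g1 g2 : gauge g1 -> gauge g2 ->
  set_bij [set v | g1 v <= 1] [set v | g2 v <= 1] (radial g1 g2).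
Proof.
move=> G1 G2; split.
- by move=> v /= v1; rewrite gauge_radial.
- by move=> u v _ _ /(can_inj (radialK G1 G2)).
- move=> v /= v1; exists (radial g2 g1 v); first by rewrite /= gauge_radial.
  exact: radialK.
Qed.

Lemma radial_image g1 g2 : gauge g1 -> gauge g2 ->
  radial g1 g2 @` [set v | g1 v = 1] = [set v | g2 v = 1].
Proof.
move=> G1 G2; apply/seteqP; split => [_ [v /= v1 <-]|v /= v1].
  by rewrite /= gauge_radial.
exists (radial g2 g1 v); first by rewrite /= gauge_radial.
exact: radialK.
Qed.

Definition euclid v : R := Num.sqrt (v.1 ^+ 2 + v.2 ^+ 2).

Lemma gauge_euclid : gauge euclid.
Proof.
split.
- have c : continuous (fun u : R * R => u.1 ^+ 2 + u.2 ^+ 2).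
    move=> u; apply: (@cvgD _ R^o).
      exact: (continuous_comp (@continuous_fst R R u) (@exprn_continuous R 2 _)).
    exact: (continuous_comp (@continuous_snd R R u) (@exprn_continuous R 2 _)).
  by move=> v; exact: (continuous_comp (c v) (@sqrt_continuous R _)).
- move=> t [a b] t0; rewrite /euclid /=.
  by rewrite !exprMn -mulrDr sqrtrM ?sqr_ge0 // sqrtr_sqr ger0_norm.
(* Both sides are written as square roots, which leaves a quadratic inequality in the absolute
   values of [a] and [b]. *)
- exists 2^-1 => // -[a b]; rewrite /euclid /norm1 /= -[leLHS]ger0_norm.
    rewrite -sqrtr_sqr ler_wsqrtr // -(real_normK (num_real a)).
    rewrite -(real_normK (num_real b)).
    have := normr_ge0 a; have := normr_ge0 b.
    by move: (`|a|) (`|b|) => x y *; nra.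
  by rewrite mulr_ge0 ?addr_ge0.
- exists 1 => -[a b]; rewrite /euclid /norm1 /= mul1r -[leRHS]ger0_norm.
    rewrite -sqrtr_sqr ler_wsqrtr // -(real_normK (num_real a)).
    rewrite -(real_normK (num_real b)).
    have := normr_ge0 a; have := normr_ge0 b.
    by move: (`|a|) (`|b|) => x y *; nra.
  by rewrite addr_ge0.
Qed.

End Gauge.

(** * Gauges of intervals and hexagons *)

Section Hexagon.
Variable R : realType.
Implicit Types (a b d : R) (v : R * R).

(** For positive [a0] and [a1], the Minkowski functional of the interval [[- a0, a1]]. *)
Definition iv_gauge a0 a1 (x : R) : R := Num.max (a1^-1 * x) (- a0^-1 * x).

Lemma iv_gaugeZ a0 a1 t x : 0 <= t -> iv_gauge a0 a1 (t * x) = t * iv_gauge a0 a1 x.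
Proof. by move=> t0; rewrite /iv_gauge mulrCA [_ * (t * x)]mulrCA maxr_pMr. Qed.

Lemma continuous_maxr (T : topologicalType) (f g : T -> R) :
  continuous f -> continuous g -> continuous (fun x => Num.max (f x) (g x)).
Proof. by move=> cf cg x; exact: (continuous_max (cf x) (cg x)). Qed.

Lemma continuous_iv_gauge a0 a1 : continuous (iv_gauge a0 a1).
Proof. by apply: continuous_maxr => x; exact: mulrl_continuous. Qed.

Lemma iv_gauge_le1 a0 a1 x :
  0 < a0 -> 0 < a1 -> (iv_gauge a0 a1 x <= 1) = (- a0 <= x <= a1).
Proof.
move=> a00 a10; rewrite /iv_gauge ge_max ler_pdivrMl // mulr1 andbC mulNr -mulrN.
by rewrite ler_pdivrMl // mulr1 lerNl.
Qed.

Lemma iv_gauge_lt1 a0 a1 x :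
  0 < a0 -> 0 < a1 -> (iv_gauge a0 a1 x < 1) = (- a0 < x < a1).
Proof.
move=> a00 a10; rewrite /iv_gauge gt_max ltr_pdivrMl // mulr1 andbC mulNr -mulrN.
by rewrite ltr_pdivrMl // mulr1 ltrNl.
Qed.

Lemma iv_gauge_lower a0 a1 x :
  0 < a0 -> 0 < a1 -> `|x| <= (a0 + a1) * iv_gauge a0 a1 x.
Proof.
move=> a00 a10.
have l1 : a1^-1 * x <= iv_gauge a0 a1 x by rewrite le_max lexx.
have l0 : - a0^-1 * x <= iv_gauge a0 a1 x by rewrite le_max lexx orbT.
have i0 : a0 * a0^-1 = 1 by rewrite divff ?gt_eqF.
have i1 : a1 * a1^-1 = 1 by rewrite divff ?gt_eqF.
have p0 : 0 < a0^-1 by rewrite invr_gt0.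
have p1 : 0 < a1^-1 by rewrite invr_gt0.
have x1 : x <= a1 * iv_gauge a0 a1 x by rewrite -ler_pdivrMl.
have x2 : - x <= a0 * iv_gauge a0 a1 x.
  by rewrite -ler_pdivrMl // mulrN -mulNr.
have g0 : 0 <= iv_gauge a0 a1 x.
  by have [x0|x0] := leP 0 x; [apply: le_trans l1|apply: le_trans l0]; nra.
have m0 : 0 <= a0 * iv_gauge a0 a1 x by rewrite mulr_ge0 // ltW.
have m1 : 0 <= a1 * iv_gauge a0 a1 x by rewrite mulr_ge0 // ltW.
by rewrite ler_norml mulrDl; apply/andP; split; lra.
Qed.

Lemma iv_gauge_upper a0 a1 x :
  0 < a0 -> 0 < a1 -> iv_gauge a0 a1 x <= (a0^-1 + a1^-1) * `|x|.
Proof.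
move=> a00 a10; have i0 : 0 < a0^-1 by rewrite invr_gt0.
have i1 : 0 < a1^-1 by rewrite invr_gt0.
rewrite ge_max; move: (a0^-1) (a1^-1) i0 i1 => p q p0 q0.
have := ler_norm x; have := ler_norm (- x); rewrite normrN => nx px.
by have := normr_ge0 x => n0; apply/andP; split; nra.
Qed.

(** The Minkowski functional of an intersection is the maximum of the functionals, here of three
    strips parallel to the lattice lines. *)
Definition hex_gauge a0 a1 b0 b1 d0 d1 v : R :=
  Num.max (iv_gauge a0 a1 v.1)
    (Num.max (iv_gauge b0 b1 v.2) (iv_gauge d0 d1 (v.1 - v.2))).

Lemma gauge_hex a0 a1 b0 b1 d0 d1 :
  0 < a0 -> 0 < a1 -> 0 < b0 -> 0 < b1 -> 0 < d0 -> 0 < d1 ->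
  gauge (hex_gauge a0 a1 b0 b1 d0 d1).
Proof.
move=> a00 a10 b00 b10 d00 d10; split.
- apply: continuous_maxr; last apply: continuous_maxr; move=> v.
  + exact: (continuous_comp (@continuous_fst R R v) (@continuous_iv_gauge _ _ _)).
  + exact: (continuous_comp (@continuous_snd R R v) (@continuous_iv_gauge _ _ _)).
  + have c : continuous (fun u : R * R => u.1 - u.2).
      move=> u; apply: (@cvgB _ R^o); [exact: continuous_fst|exact: continuous_snd].
    exact: (continuous_comp (c v) (@continuous_iv_gauge _ _ _)).
- move=> t v t0; rewrite /hex_gauge /= -mulrBr !iv_gaugeZ //.
  by rewrite -!maxr_pMr.
(* The strips in [v.1] and [v.2] already bound [norm1]. *)
- exists (a0 + a1 + b0 + b1)^-1; first by rewrite invr_gt0 !addr_gt0.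
  move=> v; rewrite ler_pdivrMl ?addr_gt0 //.
  have h1 := iv_gauge_lower v.1 a00 a10; have h2 := iv_gauge_lower v.2 b00 b10.
  have l1 : iv_gauge a0 a1 v.1 <= hex_gauge a0 a1 b0 b1 d0 d1 v.
    by rewrite le_max lexx.
  have l2 : iv_gauge b0 b1 v.2 <= hex_gauge a0 a1 b0 b1 d0 d1 v.
    by rewrite /hex_gauge le_max; apply/orP; right; rewrite le_max lexx.
  by rewrite /norm1; nra.
(* Each of the three functionals is bounded by its own summand; the one of [v.1 - v.2] also uses the
   triangle inequality. *)
- exists ((a0^-1 + a1^-1) + (b0^-1 + b1^-1) + (d0^-1 + d1^-1)) => v.
  have pos (x : R) : 0 < x -> 0 <= x^-1 by move=> ?; rewrite invr_ge0 ltW.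
  have := pos _ a00; have := pos _ a10; have := pos _ b00; have := pos _ b10.
  have := pos _ d00; have := pos _ d10.
  have h1 := iv_gauge_upper v.1 a00 a10; have h2 := iv_gauge_upper v.2 b00 b10.
  have h3 := iv_gauge_upper (v.1 - v.2) d00 d10.
  have n3 := ler_normB v.1 v.2.
  have := normr_ge0 v.1; have := normr_ge0 v.2; have := normr_ge0 (v.1 - v.2).
  move=> *; rewrite /hex_gauge ge_max [X in _ && X]ge_max /norm1; apply/and3P; split.
  + by apply: (le_trans h1); apply: ler_pM; lra.
  + by apply: (le_trans h2); apply: ler_pM; lra.
  + by apply: (le_trans h3); apply: ler_pM; lra.
Qed.

Lemma hex_gauge_le1 a0 a1 b0 b1 d0 d1 v :
  0 < a0 -> 0 < a1 -> 0 < b0 -> 0 < b1 -> 0 < d0 -> 0 < d1 ->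
  (hex_gauge a0 a1 b0 b1 d0 d1 v <= 1) =
  [&& - a0 <= v.1 <= a1, - b0 <= v.2 <= b1 & - d0 <= v.1 - v.2 <= d1].
Proof. by move=> *; rewrite /hex_gauge ge_max [X in _ && X]ge_max !iv_gauge_le1. Qed.

Lemma hex_gauge_lt1 a0 a1 b0 b1 d0 d1 v :
  0 < a0 -> 0 < a1 -> 0 < b0 -> 0 < b1 -> 0 < d0 -> 0 < d1 ->
  (hex_gauge a0 a1 b0 b1 d0 d1 v < 1) =
  [&& - a0 < v.1 < a1, - b0 < v.2 < b1 & - d0 < v.1 - v.2 < d1].
Proof. by move=> *; rewrite /hex_gauge gt_max [X in _ && X]gt_max !iv_gauge_lt1. Qed.

End Hexagon.

(** * Labels of points *)

(** Keys are binary numbers so that the final checks evaluate quickly; this lemma and the next bring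
    their arithmetic back to [nat]. *)
Lemma nat_of_addN a b : nat_of_bin (BinNat.N.add a b) = (a + b)%N.
Proof. by case: a b => [|p] [|q] //=; rewrite ?addn0 //; exact: nat_of_add_pos. Qed.

Lemma nat_of_mulN a b : nat_of_bin (BinNat.N.mul a b) = (a * b)%N.
Proof. by case: a b => [|p] [|q] //=; rewrite ?muln0 //; exact: nat_of_mul_pos. Qed.

Section Label.
Variable R : realType.
Implicit Types (x y : R) (p q : R * R) (n : int).

(* [2 n] when [x = n], and [2 n + 1] when [n < x < n + 1]. *)
Definition lab1 x : int := Num.floor x + Num.ceil x.

Lemma lab1P x : exists n : int, (x = n%:~R /\ lab1 x = 2 * n) \/
  (n%:~R < x < (n + 1)%:~R /\ lab1 x = 2 * n + 1).
Proof.
exists (Num.floor x); have /andP[f0 f1] := floor_itv x.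
have [xi|xi] := boolP (x \is a Num.int).
  left; have /intrP[n xE] := xi; rewrite /lab1 xE intrKceil intrKfloor; split=> //; lia.
right; have fx : (Num.floor x)%:~R != x by rewrite -intrEfloor.
rewrite lt_neqAle fx f0 f1; split => //.
by rewrite /lab1 ceil_floor (negPf xi) /=; set f := Num.floor x; lia.
Qed.

Lemma lab1_le x n : (lab1 x <= 2 * n) = (x <= n%:~R).
Proof.
have [m [[-> ->]|[/andP[mx xm] ->]]] := lab1P x; first by rewrite ler_int; lia.
have [mn|nm] := leP (m + 1) n; last first.
  have nmR : n%:~R <= m%:~R :> R by rewrite ler_int; lia.
  by apply/idP/idP => h; [exfalso; lia|exfalso; lra].
have mnR : (m + 1)%:~R <= n%:~R :> R by rewrite ler_int; lia.
by apply/idP/idP => h; [lra|lia].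
Qed.

Lemma lab1_ge x n : (2 * n <= lab1 x) = (n%:~R <= x).
Proof.
have [m [[-> ->]|[/andP[mx xm] ->]]] := lab1P x; first by rewrite ler_int; lia.
have [nm|mn] := leP n m.
  have nmR : n%:~R <= m%:~R :> R by rewrite ler_int; lia.
  by apply/idP/idP => h; [lra|lia].
have mnR : (m + 1)%:~R <= n%:~R :> R by rewrite ler_int; lia.
by apply/idP/idP => h; [exfalso; lia|exfalso; lra].
Qed.

Lemma lab1_lt x n : (lab1 x < 2 * n) = (x < n%:~R).
Proof. by rewrite ltNge lab1_ge -ltNge. Qed.

Lemma lab1_gt x n : (2 * n < lab1 x) = (n%:~R < x).
Proof. by rewrite ltNge lab1_le -ltNge. Qed.

Lemma lab1_even x n : (lab1 x == 2 * n) = (x == n%:~R).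
Proof. by rewrite !eq_le lab1_le lab1_ge. Qed.

Lemma lab1_odd x n : (lab1 x == 2 * n + 1) = (n%:~R < x < (n + 1)%:~R).
Proof. by rewrite -lab1_lt -lab1_gt; apply/idP/idP; lia. Qed.

Lemma lab1Dz x n : lab1 (x + n%:~R) = lab1 x + 2 * n.
Proof.
have [m [[-> ->]|[/andP[mx xm] ->]]] := lab1P x.
  by apply/eqP; rewrite -mulrDr lab1_even intrD.
apply/eqP; have -> : 2 * m + 1 + 2 * n = 2 * (m + n) + 1 by lia.
by rewrite lab1_odd !intrD in mx xm *; apply/andP; split; lra.
Qed.

Definition label : Type := (int * int * int)%type.

(* The third component is nonzero only inside triangles: the first two determine
   the label of [p.1 - p.2] unless both are odd. *)
Definition lab p : label :=
  (lab1 p.1, lab1 p.2, lab1 (p.1 - p.2) - lab1 p.1 + lab1 p.2).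

(** When the first two components are odd, the point lies in an open unit square: [0] is its
    diagonal, [1] and [-1] are the triangles below and above it. *)
Definition valid (a : label) : bool :=
  (a.2 == 0) ||
  [&& (a.1.1 %% 2 == 1)%Z, (a.1.2 %% 2 == 1)%Z & (-1 <= a.2 <= 1)].

Lemma lab_valid p : valid (lab p).
Proof.
case: p => x y; rewrite /valid /lab /=.
have [m [[-> ->]|[/andP[mx xm] xl]]] := lab1P x;
  have [n [[-> ->]|[/andP[ny yn] yl]]] := lab1P y; apply/orP.
- by left; rewrite -intrB (eqP (_ : lab1 _ == 2 * (m - n))) ?lab1_even //; lia.
- left; rewrite yl (eqP (_ : lab1 _ == 2 * (m - n - 1) + 1)) ?lab1_odd; first lia.
  by rewrite !(intrD, intrN) in ny yn *; apply/andP; split; lra.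
- left; rewrite xl (eqP (_ : lab1 _ == 2 * (m - n) + 1)) ?lab1_odd; first lia.
  by rewrite !(intrD, intrN) in mx xm *; apply/andP; split; lra.
- right; rewrite xl yl.
  have : 2 * (m - n - 1) < lab1 (x - y) < 2 * (m - n + 1).
    rewrite lab1_lt lab1_gt !(intrD, intrN) in mx xm ny yn *.
    by apply/andP; split; lra.
  by move: (lab1 (x - y)) => z ?; lia.
Qed.

(** * The torus as a quotient of the plane, and keys of its points *)

Variables N c M : int.
Hypotheses (N0 : 0 < N) (M0 : 0 < M).

(** The two angles are the coordinates of [p] in the basis [(N, 0)], [(c, M)]. The terms with [0]
    fit the shape of [continuous_lin]. *)
Definition tor p : (R * R) * (R * R) :=
  (circ (N%:~R^-1 * p.1 + - (c%:~R / (N%:~R * M%:~R)) * p.2 + 0),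
   circ (0 * p.1 + M%:~R^-1 * p.2 + 0)).

Lemma continuous_tor : continuous tor.
Proof.
apply: continuous_pair => p.
  exact: (continuous_comp (@continuous_lin R _ _ _ p) (@continuous_circ R _)).
exact: (continuous_comp (@continuous_lin R _ _ _ p) (@continuous_circ R _)).
Qed.

Lemma tor_torus p : torus R (tor p).
Proof. by split; exact: circ_unit_circle. Qed.

Definition lattice_trans (k l : int) p : R * R :=
  (p.1 + (N * k + c * l)%:~R, p.2 + (M * l)%:~R).

Lemma tor_eq p q : tor p = tor q <-> exists k l : int, p = lattice_trans k l q.
Proof.
have NR : N%:~R != 0 :> R by rewrite intr_eq0 gt_eqF.
have MR : M%:~R != 0 :> R by rewrite intr_eq0 gt_eqF.
split=> [e|[k [l ->]]].
  have /circ_eq[k kE] := congr1 fst e; have /circ_eq[l lE] := congr1 snd e.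
  exists k, l; have p2 : p.2 = q.2 + (M * l)%:~R.
    have -> : p.2 = M%:~R * (0 * p.1 + M%:~R^-1 * p.2 + 0) by field.
    by rewrite lE intrM; field.
  have p1 : p.1 = q.1 + (N * k + c * l)%:~R.
    have -> : p.1 = N%:~R * (N%:~R^-1 * p.1 + - (c%:~R / (N%:~R * M%:~R)) * p.2 + 0)
                    + c%:~R / M%:~R * p.2 by field; rewrite ?NR ?MR.
    by rewrite kE p2 intrD !intrM; field; rewrite ?NR ?MR.
  by rewrite /lattice_trans -p1 -p2; case: (p).
congr pair; apply/circ_eq.
  by exists k; rewrite /= intrD !intrM; field; rewrite ?NR ?MR.
by exists l; rewrite /= intrM; field.
Qed.

Lemma tor_surj t : torus R t -> exists p, tor p = t.
Proof.
case: t => t1 t2 [/= /circ_surj[x xE] /circ_surj[y yE]].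
have NR : N%:~R != 0 :> R by rewrite intr_eq0 gt_eqF.
have MR : M%:~R != 0 :> R by rewrite intr_eq0 gt_eqF.
exists (N%:~R * x + c%:~R * y, M%:~R * y); rewrite -xE -yE /tor /=.
by congr (circ _, circ _); field; rewrite ?NR ?MR.
Qed.

Definition label_shift (k l : int) (a : label) : label :=
  (a.1.1 + 2 * (N * k + c * l), a.1.2 + 2 * (M * l), a.2).

Lemma lab_trans k l p : lab (lattice_trans k l p) = label_shift k l (lab p).
Proof.
rewrite /lab /lattice_trans /label_shift /= !lab1Dz; congr (_, _, _).
have -> : p.1 + (N * k + c * l)%:~R - (p.2 + (M * l)%:~R) =
  p.1 - p.2 + (N * k + c * l - M * l)%:~R by rewrite intrB; ring.
by rewrite lab1Dz; lia.
Qed.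

(** Normal form of a label modulo the periods. The second coordinate is reduced first, since
    subtracting [(c, M)] moves the first one too. *)
Definition nlab (a : label) : label :=
  let l := (a.1.2 %/ (2 * M))%Z in
  (((a.1.1 - 2 * (c * l)) %% (2 * N))%Z, (a.1.2 %% (2 * M))%Z, a.2).

Lemma nlab_is_shift a : exists k l, nlab a = label_shift k l a.
Proof.
set l := (a.1.2 %/ (2 * M))%Z.
set k := ((a.1.1 - 2 * (c * l)) %/ (2 * N))%Z.
exists (- k), (- l); have := divz_eq a.1.2 (2 * M).
have := divz_eq (a.1.1 - 2 * (c * l)) (2 * N).
rewrite -/l -/k /nlab /label_shift -/l => h1 h2; congr (_, _, _).
  by move: h1; set r := (_ %% _)%Z; lia.
by move: h2; set r := (_ %% _)%Z; lia.
Qed.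

Lemma nlab_label_shift k l a : nlab (label_shift k l a) = nlab a.
Proof.
case: a => [[A B] D]; rewrite /nlab /label_shift /=.
have M2 : 2 * M != 0 by lia.
have -> : ((B + 2 * (M * l)) %/ (2 * M))%Z = (B %/ (2 * M))%Z + l.
  by rewrite mulrA addrC [2 * M * l]mulrC divzMDl // addrC.
congr (_, _, _); last by rewrite mulrA addrC [2 * M * l]mulrC modzMDl.
set q := (B %/ _)%Z.
have -> : A + 2 * (N * k + c * l) - 2 * (c * (q + l)) =
  k * (2 * N) + (A - 2 * (c * q)) by ring.
by rewrite modzMDl.
Qed.

(** The normal form as a number in mixed radix [2 * N], [2 * M]; adding 1 makes the third digit
    nonnegative. *)
Definition key (a : label) : BinNums.N :=
  let b := nlab a in
  BinNat.N.add (bin_of_nat (absz b.1.1)) (BinNat.N.mul (bin_of_nat (absz (2 * N)))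
    (BinNat.N.add (bin_of_nat (absz b.1.2))
      (BinNat.N.mul (bin_of_nat (absz (2 * M))) (bin_of_nat (absz (b.2 + 1)))))).

(** The digits of a key can be read off, so equal keys mean equal normal forms, and a normal form
    differs from its label by a period. Validity keeps the third digit nonnegative. *)
Lemma key_eq a b : valid a -> valid b ->
  key a = key b <-> exists k l, a = label_shift k l b.
Proof.
move=> va vb; split=> [|[k [l ->]]]; last by rewrite /key nlab_label_shift.
move=> /(congr1 nat_of_bin).
rewrite /key !(nat_of_addN, nat_of_mulN, bin_of_natK).
have [k [l Ea]] := nlab_is_shift a; have [k' [l' Eb]] := nlab_is_shift b.
move=> kab; suff : nlab a = nlab b.
  rewrite Ea Eb => -[h1 h2 h3]; exists (k' - k), (l' - l).
  move: a b {va vb Ea Eb kab} h1 h2 h3 => [[A B] D] [[A' B'] D'] /= h1 h2 ->.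
  by rewrite /label_shift /=; congr (_, _, _); lia.
have bnd a' : 0 <= (nlab a').1.1 < 2 * N /\ 0 <= (nlab a').1.2 < 2 * M.
  by rewrite /nlab /= !modz_ge0 ?ltz_pmod //; lia.
have d1 a' : valid a' -> -1 <= a'.2 <= 1 by rewrite /valid; lia.
have := d1 _ va; have := d1 _ vb; have := bnd a; have := bnd b.
have : (nlab a).2 = a.2 by []. have : (nlab b).2 = b.2 by [].
move: (nlab a) (nlab b) kab => [[A B] D] [[A' B'] D'] /= kab <- <-.
move: kab {Ea Eb d1 bnd} => kab [/andP[a0 a1] /andP[b0 b1]].
move=> [/andP[a0' a1'] /andP[b0' b1']] /andP[d0 d1] /andP[d0' d1'].
have H (x y z x' y' z' n m : nat) : (x < n)%N -> (x' < n)%N -> (y < m)%N ->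
   (y' < m)%N -> (x + n * (y + m * z) = x' + n * (y' + m * z'))%N ->
   [/\ x = x', y = y' & z = z'].
  have digits (u v u' v' w : nat) : (u < w)%N -> (u' < w)%N ->
      (u + w * v = u' + w * v')%N -> u = u' /\ v = v'.
    move=> uw u'w E; have w0 : (0 < w)%N by lia.
    have := congr1 (modn^~ w) E; have := congr1 (divn^~ w) E.
    rewrite /= ![(w * _)%N]mulnC ![(_ + _ * _)%N]addnC !divnMDl // !modnMDl.
    by rewrite !modn_small // !divn_small // !addn0 => -> ->.
  move=> xn x'n ym y'm E; have [-> E'] := digits _ _ _ _ _ xn x'n E.
  by have [-> ->] := digits _ _ _ _ _ ym y'm E'.
have [] := H _ _ _ _ _ _ _ _ _ _ _ _ kab; try lia.
by move=> *; congr (_, _, _); lia.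
Qed.

Definition pkey p : BinNums.N := key (lab p).

Lemma pkey_trans k l p : pkey (lattice_trans k l p) = pkey p.
Proof. by rewrite /pkey lab_trans /key nlab_label_shift. Qed.

Lemma pkey_key p a : valid a ->
  pkey p = key a <-> exists2 q, tor q = tor p & lab q = a.
Proof.
move=> va; split=> [/key_eq[||k [l E]]|[q /tor_eq[k [l ->]]]] //.
- exact: lab_valid.
- exists (lattice_trans (- k) (- l) p); first by apply/tor_eq; exists (- k), (- l).
  by rewrite lab_trans E /label_shift; case: (a) => [[A B] D] /=; congr (_, _, _); ring.
- by rewrite lab_trans /pkey => <-; rewrite /key nlab_label_shift.
Qed.

(* On the torus itself, [xget] picks some preimage under [tor]; the value does not
   depend on it by [pkey_trans]. *)
Definition tkey (t : (R * R) * (R * R)) : BinNums.N :=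
  pkey (xget (0, 0) [set p | tor p = t]).

Lemma tkey_tor p : tkey (tor p) = pkey p.
Proof.
rewrite /tkey; case: xgetP => [q _ /= /tor_eq[k [l ->]]|/(_ p)[]]//.
exact: pkey_trans.
Qed.

Definition cell (s : seq BinNums.N) : set ((R * R) * (R * R)) :=
  [set t | torus R t /\ tkey t \in s].

Lemma cell_tor s p : cell s (tor p) <-> pkey p \in s.
Proof. by rewrite /cell /= tkey_tor; split=> [[]//|]; split=> //; exact: tor_torus. Qed.

(** This turns regions of the plane into finite lists of keys: a point whose key occurs in the list
    can be moved by a period until its label lies in [s]. *)
Lemma tor_cell (s : seq label) : all valid s ->
  tor @` [set p | lab p \in s] = cell (map key s).
Proof.
move=> /allP vs; apply/seteqP; split => [_ [p /= ps <-]|t [/tor_surj[p <-]]].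
  by apply/cell_tor/map_f.
rewrite tkey_tor => /mapP[a sa /(pkey_key _ (vs _ sa))[q qp qa]].
by exists q; rewrite //= qa.
Qed.

End Label.

(** * Edges and faces *)

Local Notation pt := (int * int)%type.

Definition vlab (v : pt) : label := (2 * v.1, 2 * v.2, 0).
(* Labels double the coordinates, so for a unit step the sum of the ends labels
   the midpoint, hence the open edge. *)
Definition elab (e : pt * pt) : label := (e.1.1 + e.2.1, e.1.2 + e.2.2, 0).
Definition edge_labels (e : pt * pt) : seq label :=
  [:: vlab e.1; elab e; vlab e.2].

Definition unit_step (e : pt * pt) : bool :=
  (e.2.1 - e.1.1, e.2.2 - e.1.2) \in
    [:: (1, 0); (1, 1); (0, 1); (-1, 0); (-1, -1); (0, -1)].

Definition ptR (R : realType) (v : pt) : R * R := (v.1%:~R, v.2%:~R).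

Section Geometry.
Variable R : realType.
Implicit Types (p q : R * R) (v : pt).

Lemma lab_vlab p v : lab p = vlab v <-> p = ptR R v.
Proof.
split=> [|->].
  case: p => x y [] /eqP + /eqP + _.
  by rewrite /= !lab1_even => /eqP-> /eqP->.
rewrite /lab /= -intrB; have E n : lab1 (n%:~R : R) = 2 * n.
  by apply/eqP; rewrite lab1_even.
by rewrite !E /vlab; congr (_, _, _); ring.
Qed.

Definition segment (e : pt * pt) (s : R) : R * R :=
  (e.1.1%:~R + s * (e.2.1 - e.1.1)%:~R, e.1.2%:~R + s * (e.2.2 - e.1.2)%:~R).

Lemma continuous_segment e : continuous (segment e).
Proof.
apply: continuous_pair => s; apply: (@cvgD _ R^o).
- exact: cvg_cst.
- exact: mulrr_continuous.
- exact: cvg_cst.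
- exact: mulrr_continuous.
Qed.

Lemma segment0 e : segment e 0 = ptR R e.1.
Proof. by rewrite /segment !mul0r !addr0. Qed.

Lemma segment1 e : segment e 1 = ptR R e.2.
Proof. by rewrite /segment !mul1r !intrB; congr pair; ring. Qed.

Lemma segment_inj e : unit_step e -> injective (segment e).
Proof.
case: e => [[a1 a2] [b1 b2]]; rewrite /unit_step /segment /= => st s t [].
move=> /addrI + /addrI.
by move: st; rewrite !inE => /or4P[| | |/or3P[]] /eqP[-> ->]; lra.
Qed.

(** Along an open unit step each of [x], [y], [x - y] is either a constant integer or runs between
    two consecutive integers. Conversely a coordinate that moves gives the parameter [s]. *)
Lemma lab_open_unit e p : unit_step e ->
  lab p = elab e <-> exists2 s, 0 < s < 1 & segment e s = p.
Proof.
move=> st; split.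
  case: p => x y; rewrite /lab /elab /= => -[].
  have [d1 [d2 [E1 E2 D]]] : exists d1 d2, [/\ e.2.1 = e.1.1 + d1,
      e.2.2 = e.1.2 + d2 & (d1, d2) \in
      [:: (1, 0); (1, 1); (0, 1); (-1, 0); (-1, -1); (0, -1 : int)]].
    by exists (e.2.1 - e.1.1), (e.2.2 - e.1.2); split=> //; lia.
  rewrite /segment E1 E2 => l1 l2 l3.
  have l3' : lab1 (x - y) = 2 * (e.1.1 - e.1.2) + d1 - d2 by lia.
  have ev (z : R) n : lab1 z = 2 * n -> z = n%:~R.
    by move/eqP; rewrite lab1_even => /eqP.
  have od (z : R) n : lab1 z = 2 * n + 1 -> n%:~R < z < n%:~R + 1.
    by move/eqP; rewrite lab1_odd intrD.
  move: l1 l2 l3'; move: e.1.1 e.1.2 D => a1 a2 D l1 l2 {}l3.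
  suff : exists2 s, 0 < s < 1 & a1%:~R + s * d1%:~R = x /\ a2%:~R + s * d2%:~R = y.
    by move=> [s s01 [sx sy]]; exists s => //; rewrite -sx -sy; congr pair;
      rewrite !intrD; ring.
  (* One case per direction. For a decreasing coordinate the open interval starts at [a1 - 1] or
     [a2 - 1]. *)
  move: D; rewrite !inE => /or4P[| | |/or3P[]] /eqP[Ed1 Ed2]; subst d1 d2.
  - have /od/andP[x0 x1] : lab1 x = 2 * a1 + 1 by lia.
    have /ev y0 : lab1 y = 2 * a2 by lia.
    by exists (x - a1%:~R); [apply/andP; split; lra|split; lra].
  - have /od/andP[x0 x1] : lab1 x = 2 * a1 + 1 by lia.
    have /ev : lab1 (x - y) = 2 * (a1 - a2) by lia.
    rewrite intrB => z0.
    by exists (x - a1%:~R); [apply/andP; split; lra|split; lra].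
  - have /od/andP[x0 x1] : lab1 y = 2 * a2 + 1 by lia.
    have /ev y0 : lab1 x = 2 * a1 by lia.
    by exists (y - a2%:~R); [apply/andP; split; lra|split; lra].
  - have /od/andP[x0 x1] : lab1 x = 2 * (a1 - 1) + 1 by lia.
    have /ev y0 : lab1 y = 2 * a2 by lia.
    rewrite intrB in x0 x1.
    by exists (a1%:~R - x); [apply/andP; split; lra|split; lra].
  - have /od/andP[x0 x1] : lab1 x = 2 * (a1 - 1) + 1 by lia.
    have /ev : lab1 (x - y) = 2 * (a1 - a2) by lia.
    rewrite !intrB in x0 x1 * => z0.
    by exists (a1%:~R - x); [apply/andP; split; lra|split; lra].
  - have /od/andP[x0 x1] : lab1 y = 2 * (a2 - 1) + 1 by lia.
    have /ev y0 : lab1 x = 2 * a1 by lia.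
    rewrite intrB in x0 x1.
    by exists (a2%:~R - y); [apply/andP; split; lra|split; lra].
move=> [s /andP[s0 s1] <-].
case: e st => [[a1 a2] [b1 b2]]; rewrite /unit_step /segment /elab /lab /= => st.
have ev (z : R) n : z = n%:~R -> lab1 z = 2 * n.
  by move=> zE; apply/eqP; rewrite lab1_even zE.
have od (z : R) n : n%:~R < z < n%:~R + 1 -> lab1 z = 2 * n + 1.
  by move=> zE; apply/eqP; rewrite lab1_odd intrD.
have [d1 d1E] : exists d1 : int, d1 = b1 - a1 by eexists.
have [d2 d2E] : exists d2 : int, d2 = b2 - a2 by eexists.
have -> : b1 = a1 + d1 by lia. have -> : b2 = a2 + d2 by lia.
rewrite -d1E -d2E in st.
have -> : a1 + d1 - a1 = d1 by lia. have -> : a2 + d2 - a2 = d2 by lia.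
have fin (x y : R) (k l m A B : int) : lab1 x = k -> lab1 y = l ->
    lab1 (x - y) = m -> k = A -> l = B -> m = k - l ->
    (lab1 x, lab1 y, lab1 (x - y) - lab1 x + lab1 y) = (A, B, 0).
  by move=> -> -> -> -> -> ->; congr (_, _, _); ring.
move: st {d1E d2E}; rewrite !inE => /or4P[| | |/or3P[]] /eqP[-> ->].
- apply: (fin _ _ _ _ _ _ _ (od _ a1 _) (ev _ a2 _) (od _ (a1 - a2) _)); try lia;
    rewrite ?intrB; try (apply/andP; split); lra.
- apply: (fin _ _ _ _ _ _ _ (od _ a1 _) (od _ a2 _) (ev _ (a1 - a2) _)); try lia;
    rewrite ?intrB; try (apply/andP; split); lra.
- apply: (fin _ _ _ _ _ _ _ (ev _ a1 _) (od _ a2 _) (od _ (a1 - a2 - 1) _)); try lia;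
    rewrite ?intrB; try (apply/andP; split); lra.
- apply: (fin _ _ _ _ _ _ _ (od _ (a1 - 1) _)
    (ev _ a2 _) (od _ (a1 - a2 - 1) _)); try lia;
    rewrite ?intrB; try (apply/andP; split); lra.
- apply: (fin _ _ _ _ _ _ _ (od _ (a1 - 1) _)
    (od _ (a2 - 1) _) (ev _ (a1 - a2) _)); try lia;
    rewrite ?intrB; try (apply/andP; split); lra.
- apply: (fin _ _ _ _ _ _ _ (ev _ a1 _)
    (od _ (a2 - 1) _) (od _ (a1 - a2) _)); try lia;
    rewrite ?intrB; try (apply/andP; split); lra.
Qed.

Lemma edge_labels_valid e : all valid (edge_labels e).
Proof. by []. Qed.

Lemma lab_edge e : unit_step e ->
  [set p : R * R | lab p \in edge_labels e] = segment e @` `[0, 1].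
Proof.
move=> st; apply/seteqP; split=> [p /=|_ [s /= + <-]].
  rewrite !inE => /or3P[] /eqP.
  - move=> /lab_vlab ->; exists 0; last exact: segment0.
    by rewrite /= in_itv /= lexx ler01.
  - move=> /(lab_open_unit _ st)[s /andP[s0 s1] <-]; exists s => //=.
    by rewrite in_itv /= !ltW.
  - move=> /lab_vlab ->; exists 1; last exact: segment1.
    by rewrite /= in_itv /= lexx ler01.
rewrite in_itv /= => /andP[s0 s1].
have [->|n0] := eqVneq s 0.
  by rewrite segment0 !inE (_ : lab _ = vlab e.1) ?eqxx //; apply/lab_vlab.
have [->|n1] := eqVneq s 1.
  by rewrite segment1 !inE (_ : lab _ = vlab e.2) ?eqxx ?orbT //; apply/lab_vlab.
rewrite !inE (_ : lab _ = elab e) ?eqxx ?orbT //.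
apply/(lab_open_unit _ st); exists s => //.
by rewrite !lt_neqAle eq_sym n0 n1 s0.
Qed.

End Geometry.

(** * Hexagonal boxes and their parametrization by the disc *)

Record box := Box { bx0 : int; bx1 : int; by0 : int; by1 : int; bz0 : int; bz1 : int }.

Definition zrange (a b : int) : seq int :=
  [seq a + i%:Z | i <- iota 0 (absz (b - a)).+1].

Definition in_box (b : box) (a : label) : bool :=
  [&& 2 * bx0 b <= a.1.1 <= 2 * bx1 b, 2 * by0 b <= a.1.2 <= 2 * by1 b &
      2 * bz0 b <= a.1.1 - a.1.2 + a.2 <= 2 * bz1 b].

(* Only meaningful for labels in the box. *)
Definition on_rim (b : box) (a : label) : bool :=
  ~~ [&& 2 * bx0 b < a.1.1 < 2 * bx1 b, 2 * by0 b < a.1.2 < 2 * by1 b &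
         2 * bz0 b < a.1.1 - a.1.2 + a.2 < 2 * bz1 b].

Definition box_candidates (b : box) : seq label :=
  [seq (a, d) |
    a <- [seq (x, y) | x <- zrange (2 * bx0 b) (2 * bx1 b),
                       y <- zrange (2 * by0 b) (2 * by1 b)],
    d <- [:: -1; 0; 1]].

Definition box_labels (b : box) : seq label :=
  [seq a <- box_candidates b | valid a && in_box b a].

Definition foldz (op : int -> int -> int) (s : seq int) : int :=
  foldr op (head 0 s) (behead s).

(** For the faces drawn here the ranges of [x], [y] and [x - y] describe the polygon itself, which
    [face_ok] confirms by comparing the rim with the sides. *)
Definition hull (F : seq pt) : box :=
  let xs := [seq v.1 | v <- F] in let ys := [seq v.2 | v <- F] in
  let zs := [seq v.1 - v.2 | v <- F] in
  Box (foldz Order.min xs) (foldz Order.max xs)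
      (foldz Order.min ys) (foldz Order.max ys)
      (foldz Order.min zs) (foldz Order.max zs).

Definition sides (F : seq pt) : seq (pt * pt) :=
  [seq (nth (0, 0) F i, nth (0, 0) F (i.+1 %% size F)%N) | i <- iota 0 (size F)].

Definition rim_labels (F : seq pt) : seq label :=
  flatten (map edge_labels (sides F)).

Lemma mem_zrange a b z : a <= z <= b -> z \in zrange a b.
Proof.
move=> /andP[az zb]; apply/mapP; exists (absz (z - a)); last by lia.
by rewrite mem_iota; lia.
Qed.

Section Tile.
Variable R : realType.
Implicit Types (p q v : R * R) (b : box).

Definition box_real b p : bool :=
  [&& (bx0 b)%:~R <= p.1 <= (bx1 b)%:~R, (by0 b)%:~R <= p.2 <= (by1 b)%:~R &
      (bz0 b)%:~R <= p.1 - p.2 <= (bz1 b)%:~R].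

Lemma in_box_lab b p : in_box b (lab p) = box_real b p.
Proof.
rewrite /in_box /box_real /=.
have -> : lab1 p.1 - lab1 p.2 + (lab1 (p.1 - p.2) - lab1 p.1 + lab1 p.2) =
  lab1 (p.1 - p.2) by ring.
by rewrite !lab1_le !lab1_ge.
Qed.

Lemma lab_box b p : (lab p \in box_labels b) = box_real b p.
Proof.
rewrite mem_filter lab_valid -in_box_lab andTb; apply: andb_idr => inb.
have /and3P[A B C] := inb.
have := lab_valid p; case: (lab p) inb A B C => [[x y] d] inb /= A B C v.
apply/allpairsP; exists ((x, y), d); split; [| |by []].
  by apply/allpairsP; exists (x, y); split; [exact: mem_zrange|exact: mem_zrange|].
by move: v; rewrite /valid !inE /=; lia.
Qed.

Lemma on_rim_lab b p : on_rim b (lab p) =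
  ~~ [&& (bx0 b)%:~R < p.1 < (bx1 b)%:~R, (by0 b)%:~R < p.2 < (by1 b)%:~R &
      (bz0 b)%:~R < p.1 - p.2 < (bz1 b)%:~R].
Proof.
rewrite /on_rim /=.
have -> : lab1 p.1 - lab1 p.2 + (lab1 (p.1 - p.2) - lab1 p.1 + lab1 p.2) =
  lab1 (p.1 - p.2) by ring.
by rewrite !lab1_lt !lab1_gt.
Qed.

Definition box_gauge b q : R * R -> R :=
  hex_gauge (q.1 - (bx0 b)%:~R) ((bx1 b)%:~R - q.1)
    (q.2 - (by0 b)%:~R) ((by1 b)%:~R - q.2)
    (q.1 - q.2 - (bz0 b)%:~R) ((bz1 b)%:~R - (q.1 - q.2)).

Definition in_open_box b q : bool :=
  [&& (bx0 b)%:~R < q.1 < (bx1 b)%:~R, (by0 b)%:~R < q.2 < (by1 b)%:~R &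
      (bz0 b)%:~R < q.1 - q.2 < (bz1 b)%:~R].

Definition translate q v : R * R := (q.1 + v.1, q.2 + v.2).

Lemma box_gauge_gauge b q : in_open_box b q -> gauge (box_gauge b q).
Proof.
by move=> /and3P[/andP[? ?] /andP[? ?] /andP[? ?]]; apply: gauge_hex; lra.
Qed.

Lemma box_gauge_le1 b q v : in_open_box b q ->
  (box_gauge b q v <= 1) = (lab (translate q v) \in box_labels b).
Proof.
move=> /and3P[/andP[? ?] /andP[? ?] /andP[? ?]].
rewrite lab_box /box_real /translate /box_gauge hex_gauge_le1; try lra.
move=> /=; apply/idP/idP => /and3P[/andP[? ?] /andP[? ?] /andP[? ?]];
  by apply/and3P; split; apply/andP; split; lra.
Qed.

(** The value 1 means at most 1 but not less than 1, and the strict inequality describes the open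
    box. *)
Lemma box_gauge_eq1 b q v : in_open_box b q ->
  (box_gauge b q v == 1) =
  (lab (translate q v) \in box_labels b) && on_rim b (lab (translate q v)).
Proof.
move=> qb; rewrite eq_le -box_gauge_le1 // andbC [RHS]andbC; congr (_ && _).
move: qb => /and3P[/andP[? ?] /andP[? ?] /andP[? ?]].
rewrite leNgt on_rim_lab /translate /box_gauge hex_gauge_lt1; try lra.
congr (~~ _).
move=> /=; apply/idP/idP => /and3P[/andP[? ?] /andP[? ?] /andP[? ?]];
  by apply/and3P; split; apply/andP; split; lra.
Qed.

Lemma unit_discE : unit_disc R = [set v | euclid v <= 1].
Proof.
apply/seteqP; split=> v; rewrite /unit_disc /euclid /=;
  by have := @ler_sqrt R (v.1 ^+ 2 + v.2 ^+ 2) 1 ler01; rewrite sqrtr1 => ->.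
Qed.

Lemma unit_circleE : unit_circle R = [set v | euclid v = 1].
Proof.
apply/seteqP; split=> v; rewrite /unit_circle /euclid /=.
  by move=> ->; rewrite sqrtr1.
move=> /(congr1 (fun x => x ^+ 2)).
by rewrite sqr_sqrtr ?expr1n // addr_ge0 ?sqr_ge0.
Qed.

Definition disc_box b q v : R * R := translate q (radial (@euclid R) (box_gauge b q) v).

Lemma continuous_disc_box b q : in_open_box b q -> continuous (disc_box b q).
Proof.
move=> qb v; have cr := continuous_radial (gauge_euclid R) (box_gauge_gauge qb).
have ct : continuous (translate q).
  apply: continuous_pair => u; apply: (@cvgD _ R^o); try exact: cvg_cst.
    exact: continuous_fst.
  exact: continuous_snd.
exact: (continuous_comp (cr v) (ct _)).
Qed.

Lemma translateK q : cancel (translate q) (translate (- q.1, - q.2)).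
Proof. by case=> x y; rewrite /translate /=; congr pair; ring. Qed.

Lemma translateNK q : cancel (translate (- q.1, - q.2)) (translate q).
Proof. by case=> x y; rewrite /translate /=; congr pair; ring. Qed.

Lemma disc_box_bij b q : in_open_box b q ->
  set_bij (unit_disc R) [set p | lab p \in box_labels b] (disc_box b q).
Proof.
move=> qb; rewrite unit_discE.
have [rf ri rs] := radial_bij (gauge_euclid R) (box_gauge_gauge qb).
split=> [v /rf /=|u v /ri ruv /ruv{}ruv|p /= pb].
- by rewrite box_gauge_le1.
- by move=> /(can_inj (translateK q)) /ruv.
- have [|v v1 vE] := rs (translate (- q.1, - q.2) p).
    by rewrite /= box_gauge_le1 // translateNK.
  by exists v => //; rewrite /disc_box vE translateNK.
Qed.

Lemma disc_box_circle b q : in_open_box b q ->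
  disc_box b q @` unit_circle R =
  [set p | (lab p \in box_labels b) && on_rim b (lab p)].
Proof.
move=> qb; rewrite unit_circleE.
have ri := radial_image (gauge_euclid R) (box_gauge_gauge qb).
rewrite (_ : disc_box b q = translate q \o radial (@euclid R) (box_gauge b q)) //.
rewrite -image_comp ri; apply/seteqP; split=> [_ [v /= /eqP + <-]|p /= pb].
  by rewrite box_gauge_eq1.
exists (translate (- q.1, - q.2) p); last exact: translateNK.
by apply/eqP; rewrite box_gauge_eq1 // translateNK.
Qed.

End Tile.

(** * The polyhedral map *)

Section Cells.
Variables (N c M : int) (V : seq pt) (E : seq (pt * pt)) (Fs : seq (seq pt)).

Local Notation key := (key N c M).

Definition vkey (v : pt) : BinNums.N := key (vlab v).
Definition ekeys (e : pt * pt) : seq BinNums.N := map key (edge_labels e).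
Definition fkeys (F : seq pt) : seq BinNums.N := map key (box_labels (hull F)).

(** Sorting lets lists of keys be compared up to order, so that an edge and its reverse agree. *)
Definition kset (s : seq BinNums.N) : seq BinNums.N := sort BinNat.N.leb s.

Definition tile_map (R : realType) : cells ((R * R) * (R * R))%type :=
  Cells (cell N c M (map vkey V))
    [set cell N c M (ekeys e) | e in [set` E]]
    [set cell N c M (fkeys F) | F in [set` Fs]].

(* The centroid of the vertices is an interior point of the hull. *)
Definition center_ok (F : seq pt) : bool :=
  let b := hull F in let n := (size F)%:Z in
  let x := foldr +%R 0 (map fst F) in let y := foldr +%R 0 (map snd F) in
  [&& n * bx0 b < x < n * bx1 b, n * by0 b < y < n * by1 b &
      n * bz0 b < x - y < n * bz1 b].

(** The bounds by [N] and [M] make [tor] injective on the hull; the last two tests identify the rim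
    of the hull with the union of the sides. *)
Definition face_ok (F : seq pt) : bool :=
  let b := hull F in let L := box_labels b in let rim := rim_labels F in
  [&& (3 <= size F)%N, uniq (map vkey F), bx1 b - bx0 b < N,
      by1 b - by0 b < M, center_ok F, all unit_step (sides F),
      all (fun a => on_rim b a == (a \in rim)) L & all (mem L) rim].

(** The last test says that a face meets the skeleton exactly in its rim. *)
Definition faces_ok : bool :=
  let sk := flatten (map ekeys E) in
  let ek := [seq kset (ekeys e) | e <- E] in
  let vk := map vkey V in
  all (fun F => let b := hull F in
     [&& face_ok F, all (fun v => vkey v \in vk) F,
         all (fun s => kset (ekeys s) \in ek) (sides F) &
         all (fun a => on_rim b a == (key a \in sk)) (box_labels b)]) Fs.

(* Entry 1 of [ekeys e] is the key of the open edge. *)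
Definition edges_ok : bool :=
  let vk := map vkey V in let ek := map ekeys E in
  [&& all (fun v => vkey v \in flatten ek) V, all unit_step E,
      all (fun e => [&& vkey e.1 \in vk, vkey e.2 \in vk & key (elab e) \notin vk]) E &
      all (fun s => all (fun s' =>
        (nth BinNums.N0 s 1 \notin s') || (kset s == kset s')) ek) ek].

(** The rectangle [[0, N] x [0, M]] contains a fundamental domain whatever [c] is; on it [x - y]
    ranges from [- M] to [N]. *)
Definition cover_ok : bool :=
  let fk := flatten (map fkeys Fs) in
  all (fun a => key a \in fk) (box_labels (Box 0 N 0 M (- M) N)).

Definition meet_ok (vk : seq BinNums.N) (ek : seq (seq BinNums.N))
    (s s' : seq BinNums.N) : bool :=
  let m := [seq k <- s | k \in s'] in
  [|| m == [::], (size m == 1) && (head BinNums.N0 m \in vk), kset m \in ek | s == s'].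

Definition faces_meet_ok : bool :=
  let vk := map vkey V in let ek := [seq kset (ekeys e) | e <- E] in
  let fk := map fkeys Fs in
  all (fun s => all (meet_ok vk ek s) fk) fk.

Definition polyhedral_ok : bool :=
  [&& 1 < N, 1 < M, cover_ok, edges_ok, faces_ok & faces_meet_ok].

Lemma kset_mem s s' : kset s = kset s' -> s =i s'.
Proof.
move=> ss' k; rewrite -(mem_sort BinNat.N.leb s) -(mem_sort BinNat.N.leb s').
by rewrite -/(kset _) ss'.
Qed.

(** * From the finite checks to a polyhedral map *)

Section Topology.
Variable R : realType.
Hypothesis ok : polyhedral_ok.

Local Notation tor := (@tor R N c M).
Local Notation cell := (@cell R N c M).
Local Notation tkey := (@tkey R N c M).
Local Notation tmap := (tile_map R).

Let N1 : 1 < N. Proof. by case/andP: ok. Qed.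
Let M1 : 1 < M. Proof. by case/and3P: ok. Qed.
Let N0 : 0 < N. Proof. exact: lt_trans N1. Qed.
Let M0 : 0 < M. Proof. exact: lt_trans M1. Qed.

Lemma cell_mem s s' : s =i s' -> cell s = cell s'.
Proof.
by move=> ss'; apply/seteqP; split=> t [tt]; rewrite /cell /= ss' => ts; split.
Qed.

Lemma tkey_vkey v : tkey (tor (ptR R v)) = vkey v.
Proof. by rewrite tkey_tor // /pkey (_ : lab _ = vlab v) //; apply/lab_vlab. Qed.

Lemma tkey_vkey_eq t v : torus R t -> tkey t = vkey v <-> t = tor (ptR R v).
Proof.
move=> /(tor_surj c N0 M0)[p <-]; split=> [|->]; last exact: tkey_vkey.
rewrite tkey_tor // => /(pkey_key c N0 M0 _ (isT : valid (vlab v)))[q <-].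
by move=> /lab_vlab ->.
Qed.

Lemma vertsP t : verts tmap t <-> exists2 v, v \in V & t = tor (ptR R v).
Proof.
split=> [[tt /mapP[v vV /(tkey_vkey_eq _ tt) tv]]|[v vV ->]]; first by exists v.
by split; [exact: tor_torus|rewrite tkey_vkey map_f].
Qed.

(** The second coordinate shows that no multiple of [(c, M)] is involved; then the first excludes
    multiples of [(N, 0)]. *)
Lemma tor_inj p q : `|p.1 - q.1| < N%:~R -> `|p.2 - q.2| < M%:~R ->
  tor p = tor q -> p = q.
Proof.
move=> pq1 pq2 /(tor_eq c N0 M0)[k [l E1]].
have E2 : p.2 - q.2 = (M * l)%:~R by rewrite E1 /= addrAC subrr add0r.
have l0 : l = 0.
  by move: pq2; rewrite E2 -intr_norm ltr_int; nia.
have E3 : p.1 - q.1 = (N * k)%:~R by rewrite E1 l0 /= mulr0 addr0 addrAC subrr add0r.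
have k0 : k = 0.
  by move: pq1; rewrite E3 -intr_norm ltr_int; nia.
by rewrite E1 l0 k0 /lattice_trans !mulr0 addr0 !addr0; case: (q).
Qed.

Lemma edge_arc e : unit_step e ->
  is_arc R (tor (ptR R e.1)) (tor (ptR R e.2)) (cell (ekeys e)).
Proof.
move=> st; exists (tor \o @segment R e); split.
- apply: continuous_subspaceT => s.
  exact: (continuous_comp (@continuous_segment R e s) (@continuous_tor R N c M _)).
- have <- := tor_cell R c N0 M0 (edge_labels_valid e); rewrite lab_edge //.
  split=> [s /= s01|s t /set_mem s01 /set_mem t01 /= /tor_inj st_eq|
    _ [_ [s /= s01 <-] <-]].
  + by exists (segment e s) => //; exists s.
  + apply: (segment_inj st).
    (* Coordinates vary by at most 1 on a unit segment, and [N] and [M] are at least 2, so [tor_inj]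
       applies. *)
    have N2 : 2 <= N%:~R :> R by rewrite (ler_int R 2); lia.
    have M2 : 2 <= M%:~R :> R by rewrite (ler_int R 2); lia.
    move: s01 t01 st; rewrite /= !in_itv /= /unit_step => /andP[s0 s1] /andP[t0 t1].
    move=> st; apply: st_eq; rewrite /segment /= ltr_norml; move: st;
      rewrite !inE => /or4P[| | |/or3P[]] /eqP[E1 E2];
      by rewrite ?E1 ?E2; apply/andP; split; lra.
  + by exists s.
- by rewrite /= segment0.
- by rewrite /= segment1.
Qed.

Lemma edges_okP e : e \in E -> [/\ unit_step e, vkey e.1 \in map vkey V,
  vkey e.2 \in map vkey V & key (elab e) \notin map vkey V].
Proof.
move=> eE; have /and5P[_ _ _ /and4P[_ /allP us /allP ev _] _] := ok.
by have /and3P[? ? ?] := ev e eE; split=> //; exact: us.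
Qed.

(** By the first test of [edges_ok] every vertex lies on an edge. *)
Lemma skeleton_cell : skeleton tmap = cell (flatten (map ekeys E)).
Proof.
apply/seteqP; split=> t.
  case=> [[tt /mapP[v vV tv]]|[_ [e /= eE <-] [tt te]]]; split=> //.
    have /and5P[_ _ _ /and4P[/allP vsk _ _ _] _] := ok.
    by rewrite tv; exact: vsk.
  by apply/flattenP; exists (ekeys e) => //; exact: map_f.
move=> [tt /flattenP[_ /mapP[e eE ->] te]]; right.
by exists (cell (ekeys e)) => //; exists e.
Qed.

Lemma mem_skeleton p : skeleton tmap (tor p) <-> key (lab p) \in flatten (map ekeys E).
Proof. by rewrite skeleton_cell; exact: cell_tor. Qed.

Lemma rim_cell F : cell (map key (rim_labels F)) =
  \bigcup_(i in `I_(size F))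
    cell (ekeys (nth (0, 0) F i, nth (0, 0) F (i.+1 %% size F)%N)).
Proof.
apply/seteqP; split=> [t [tt /mapP[a /flattenP[s /mapP[e eF ->] ea] ta]]|
  t [i iF [tt te]]].
  have /mapP[i + eE] := eF; rewrite mem_iota => iF; rewrite {}eE in ea.
  by exists i => //; split=> //; rewrite ta; exact: map_f.
split=> //; have /mapP[a ea ->] := te; apply: map_f; apply/flattenP.
exists (edge_labels (nth (0, 0) F i, nth (0, 0) F (i.+1 %% size F)%N)) => //.
by apply: map_f; apply/mapP; exists i => //; rewrite mem_iota.
Qed.

Lemma all_valid_box b : all valid (box_labels b).
Proof. by apply/allP => a; rewrite mem_filter => /andP[/andP[]]. Qed.

Lemma faces_okP F : F \in Fs ->
  [/\ face_ok F, all (fun v => vkey v \in map vkey V) F,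
     all (fun s => kset (ekeys s) \in [seq kset (ekeys e) | e <- E]) (sides F) &
     all (fun a => on_rim (hull F) a == (key a \in flatten (map ekeys E)))
       (box_labels (hull F))].
Proof.
move=> FF; have /and5P[_ _ _ _ /andP[/allP fok _]] := ok.
by have /and4P := fok F FF.
Qed.

(** The disc is the hull, parametrized around the centroid of the vertices and wrapped onto the
    torus; [tor] is injective there because the hull is narrower than [N] and [M]. The boundary
    conditions are the tests of [face_ok] and [faces_ok], transported by [tor_cell]. *)
Lemma face_ngon F : F \in Fs -> ngon R tmap (size F) (cell (fkeys F)).
Proof.
move=> FF; have [fok /allP vF /allP sF /allP skF] := faces_okP FF.
have /and5P[F3 uF wx wy /and4P[cF /allP us /allP rimL /allP Lrim']] := fok.
have Lrim a : a \in rim_labels F -> a \in box_labels (hull F) := Lrim' a.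
pose n := size F; pose b := hull F.
pose x := foldr +%R 0 (map fst F); pose y := foldr +%R 0 (map snd F).
pose q : R * R := (x%:~R / n%:R, y%:~R / n%:R).
have n0 : 0 < n%:R :> R by rewrite ltr0n; apply: leq_trans F3.
have qb : in_open_box b q.
  have lt1 (z w : int) : n%:Z * z < w -> z%:~R < w%:~R / n%:R :> R.
    by move=> zw; rewrite ltr_pdivlMr // mulrC -[n%:R]/(n%:~R) -intrM ltr_int.
  have lt2 (z w : int) : w < n%:Z * z -> w%:~R / n%:R < z%:~R :> R.
    by move=> zw; rewrite ltr_pdivrMr // mulrC -[n%:R]/(n%:~R) -intrM ltr_int.
  have /and3P[/andP[? ?] /andP[? ?] /andP[? ?]] := cF.
  have qE : q.1 - q.2 = (x - y)%:~R / n%:R by rewrite intrB mulrBl.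
  by rewrite /in_open_box qE /=; apply/and3P; split; apply/andP; split;
    (exact: lt1 || exact: lt2).
have tcE : tor @` [set p | lab p \in box_labels b] = cell (fkeys F).
  exact: (tor_cell R c N0 M0 (all_valid_box b)).
have [df di ds] := disc_box_bij qb.
have circE : (tor \o disc_box b q) @` unit_circle R = cell (map key (rim_labels F)).
  rewrite -image_comp disc_box_circle // -(tor_cell R c N0 M0); last first.
    by apply/allP => a /Lrim; exact: (allP (all_valid_box b)).
  congr (_ @` _); apply/seteqP; split=> p /=.
    by move=> /andP[pL]; rewrite (eqP (rimL _ pL)).
  by move=> pr; rewrite (Lrim _ pr) (eqP (rimL _ (Lrim _ pr))).
exists (tor \o disc_box b q), (fun i => tor (ptR R (nth (0, 0) F i))).
exists (fun i => cell (ekeys (nth (0, 0) F i, nth (0, 0) F (i.+1 %% n)%N))).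
split.
- split.
    have cd := @continuous_disc_box R b q qb; apply: continuous_subspaceT => v.
    exact: (continuous_comp (cd v) (@continuous_tor R N c M (disc_box b q v))).
  rewrite -tcE; split=> [v /df vb|u v uD vD /= |_ [p /= /ds[v vD <-] <-]].
  + by exists (disc_box b q v).
  + move: (df u (set_mem uD)) (df v (set_mem vD)); rewrite /= !lab_box.
    move=> /and3P[/andP[? ?] /andP[? ?] _] /and3P[/andP[? ?] /andP[? ?] _].
    move=> tE; apply: di => //; apply: tor_inj tE; rewrite ltr_norml.
      have : (bx1 b - bx0 b)%:~R < N%:~R :> R by rewrite ltr_int.
      by rewrite intrB => ?; apply/andP; split; lra.
    have : (by1 b - by0 b)%:~R < M%:~R :> R by rewrite ltr_int.
    by rewrite intrB => ?; apply/andP; split; lra.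
  + by exists v.
- split=> // [i j /set_mem iF /set_mem jF /= ij|i iF].
    apply/eqP; rewrite -(nth_uniq BinNums.N0 _ _ uF) ?size_map //.
    by rewrite !(nth_map (0, 0)) // -!tkey_vkey ij.
  split; [exact: tor_torus|rewrite tkey_vkey]; apply: vF; exact: mem_nth.
- move=> i iF; pose s := (nth (0, 0) F i, nth (0, 0) F (i.+1 %% n)%N).
  have sS : s \in sides F by apply/mapP; exists i; rewrite // mem_iota.
  split; last exact: edge_arc (us _ sS).
  have /mapP[e eE /kset_mem se] := sF _ sS.
  by exists e => //; apply: cell_mem => k; rewrite -se.
- by rewrite circE rim_cell.
- rewrite circE -tcE; apply/seteqP; split=> [_ [[p /= pb <-] /mem_skeleton psk]|t].
    apply/cell_tor => //; apply: map_f.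
    by rewrite -(eqP (rimL _ pb)) (eqP (skF _ pb)).
  rewrite -(tor_cell R c N0 M0); last first.
    by apply/allP => a /Lrim; exact: (allP (all_valid_box b)).
  move=> [p /= pr <-]; have pb := Lrim _ pr; split; first by exists p.
  by apply/mem_skeleton; rewrite -(eqP (skF _ pb)) (eqP (rimL _ pb)).
Qed.

Lemma vkey_inj v w : vkey v = vkey w -> tor (ptR R v) = tor (ptR R w).
Proof. by move=> vw; apply/tkey_vkey_eq; rewrite ?tkey_vkey //; exact: tor_torus. Qed.

Lemma mem_verts v : vkey v \in map vkey V -> verts tmap (tor (ptR R v)).
Proof. by move=> vV; split; [exact: tor_torus|rewrite tkey_vkey]. Qed.

Lemma ekeys_mem e k :
  (k \in ekeys e) = [|| k == vkey e.1, k == key (elab e) | k == vkey e.2].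
Proof. by rewrite /ekeys /edge_labels /= !inE. Qed.

Lemma edge_verts e : e \in E ->
  cell (ekeys e) `&` verts tmap = [set tor (ptR R e.1); tor (ptR R e.2)].
Proof.
move=> /edges_okP[st e1 e2 em]; apply/seteqP; split=> [t [[tt]]|t].
  rewrite ekeys_mem => /or3P[] /eqP te [_ tV].
  - by left; apply/tkey_vkey_eq.
  - by rewrite te (negPf em) in tV.
  - by right; apply/tkey_vkey_eq.
by case=> ->; (split; [|exact: mem_verts]); (split; first exact: tor_torus);
  rewrite tkey_vkey ekeys_mem eqxx ?orbT.
Qed.

Lemma finite_all_cells : finite_set (all_cells tmap).
Proof.
rewrite /all_cells !finite_setU; split; first split.
- apply: finite_image.
  apply: (sub_finite_set _ (finite_image (fun v => tor (ptR R v)) (finite_seq V))).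
  by move=> t /vertsP[v vV ->]; exists v.
- exact: finite_image (finite_seq E).
- exact: finite_image (finite_seq Fs).
Qed.

Lemma all_cells_sub A : all_cells tmap A -> A `<=` torus R.
Proof.
case=> [[[v [tv _] <-]|[e _ <-]]|[F _ <-]] t; first by move=> ->.
  by case.
by case.
Qed.

Lemma cover_cells t : torus R t -> exists2 F, F \in Fs & cell (fkeys F) t.
Proof.
move=> /[dup] tt /(tor_surj c N0 M0)[p0 p0E].
have NR : 0 < N%:~R :> R by rewrite ltr0z.
have MR : 0 < M%:~R :> R by rewrite ltr0z.
(* A preimage is moved into the rectangle of [cover_ok]: multiples of [(c, M)] adjust the second
   coordinate, then multiples of [(N, 0)] the first. *)
pose l := Num.floor (p0.2 / M%:~R).
pose k := Num.floor ((p0.1 - (c * l)%:~R) / N%:~R).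
pose p := lattice_trans N c M (- k) (- l) p0.
have pt : tor p = t by rewrite -p0E; apply/tor_eq => //; exists (- k), (- l).
have fl (x : R) (n : int) : 0 < n%:~R :> R ->
    0 <= x - (n * Num.floor (x / n%:~R))%:~R <= n%:~R.
  move=> n0; have /andP[f1 f2] := floor_itv (x / n%:~R).
  have := ler_wpM2l (ltW n0) f1; have := ler_wpM2l (ltW n0) (ltW f2).
  rewrite mulrCA divff ?gt_eqF // mulr1 intrD mulrDr mulr1 intrM => *.
  by apply/andP; split; lra.
have pb : lab p \in box_labels (Box 0 N 0 M (- M) N).
  have E2 : p.2 = p0.2 - (M * l)%:~R by rewrite /p /= mulrN intrN.
  have E1 : p.1 = p0.1 - (c * l)%:~R - (N * k)%:~R.
    by rewrite /p /= !mulrN intrD !intrN; ring.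
  rewrite lab_box /box_real E1 E2 /=.
  have := fl p0.2 M MR; have := fl (p0.1 - (c * l)%:~R) N NR; rewrite -/l -/k.
  move: (p0.1 - _ - _) (p0.2 - _) => x y /andP[x0 x1] /andP[y0 y1].
  by rewrite intrN; apply/and3P; split; apply/andP; split; lra.
have /and4P[_ _ /allP cov _] := ok.
have /flattenP[_ /mapP[F FF ->] kF] := cov _ pb.
by exists F => //; rewrite -pt; apply/cell_tor.
Qed.

(** A common point is either an end of [e] or has the key of the open edge; in the second case
    [edges_ok] makes the two key sets equal. *)
Lemma edge_meet e e' : e \in E -> e' \in E -> cell (ekeys e) <> cell (ekeys e') ->
  cell (ekeys e) `&` cell (ekeys e') `<=` verts tmap.
Proof.
move=> eE eE' ne t [[tt te] [_ te']].
have [_ e1 e2 _] := edges_okP eE.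
have /and5P[_ _ _ /and4P[_ _ _ /allP dj] _] := ok.
have /allP/(_ _ (map_f _ eE')) := dj _ (map_f _ eE).
move=> /orP[|/eqP/kset_mem/cell_mem//].
move: te; rewrite ekeys_mem => /or3P[] /eqP te.
- by move=> _; split; rewrite // te.
- by rewrite /= -te te'.
- by move=> _; split; rewrite // te.
Qed.

Lemma face_meet F G : F \in Fs -> G \in Fs ->
  cell (fkeys F) <> cell (fkeys G) ->
  [\/ cell (fkeys F) `&` cell (fkeys G) = set0,
      exists2 v, verts tmap v & cell (fkeys F) `&` cell (fkeys G) = [set v] |
      edges tmap (cell (fkeys F) `&` cell (fkeys G))].
Proof.
move=> FF GG ne; have /and5P[_ _ _ _ /andP[_ /allP mt]] := ok.
have /allP/(_ _ (map_f _ GG)) := mt _ (map_f _ FF).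
set m := [seq k <- fkeys F | k \in fkeys G].
have mE : cell (fkeys F) `&` cell (fkeys G) = cell m.
  apply/seteqP; split=> [t [[tt tF] [_ tG]]|t [tt]].
    by split=> //; rewrite mem_filter tG.
  by rewrite mem_filter => /andP[tG tF].
rewrite mE /meet_ok -/m =>
  /or4P[/eqP m0|/andP[/eqP m1 mV]|/mapP[e eE /kset_mem me]|/eqP FG].
- by apply: Or31; rewrite m0; apply/seteqP; split=> t // [].
- case: (m) m1 mV => [|k [|]] //= _ /mapP[v vV ->]; apply: Or32.
  exists (tor (ptR R v)); first by apply: mem_verts; exact: map_f.
  apply/seteqP; split=> [t [tt]|t ->].
    by rewrite inE => /eqP /(tkey_vkey_eq _ tt).
  by split; [exact: tor_torus|rewrite tkey_vkey inE].
- by apply: Or33; exists e => //; apply: cell_mem => k; rewrite -me.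
- by case: ne; rewrite FG.
Qed.

Lemma tile_map_polyhedral : polyhedral_map R (torus R) tmap.
Proof.
split.
- apply/seteqP; split=> [t [A /all_cells_sub]|t /cover_cells[F FF tF]]; first exact.
  by exists (cell (fkeys F)) => //; right; exists F.
(* There are finitely many cells, so the whole space serves as the neighbourhood. *)
- move=> t tt; exists setT; first exact: filterT.
  by apply: sub_finite_set finite_all_cells => A [].
- split=> [_ [e eE <-]|_ _ [e eE <-] [e' eE' <-]]; last exact: edge_meet.
  exists (tor (ptR R e.1)), (tor (ptR R e.2)); have [st _ _ _] := edges_okP eE.
  by split; [exact: edge_arc|exact: edge_verts].
- by move=> _ [F FF <-]; exists (size F); exact: face_ngon.
- by move=> _ _ [F FF <-] [G GG <-]; exact: face_meet.
Qed.

End Topology.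
End Cells.

(** * Face-cycles *)

Local Notation keyed_face := (seq pt * seq BinNums.N * seq (seq BinNums.N))%type.

Section Vertices.
Variables (N c M : int) (V : seq pt) (E : seq (pt * pt)) (Fs : seq (seq pt)).

Local Notation key := (key N c M).
Local Notation vkey := (vkey N c M).
Local Notation ekeys := (ekeys N c M).
Local Notation fkeys := (fkeys N c M).

(** The keys travel with the face, so that they are computed once and not again at every vertex. *)
Definition keyed (F : seq pt) : keyed_face := (F, fkeys F, map ekeys (sides F)).

Definition ring_ok (v : BinNums.N) (s : seq keyed_face) : bool :=
  all (fun i => let g := (nth ([::], [::], [::]) s (i.+1 %% size s)%N).1.2 in
     has (fun e => (v \in e) && all (mem g) e) (nth ([::], [::], [::]) s i).2)
   (iota 0 (size s)).

(** Different faces at [v] must be different as sets, which a vertex of one outside the other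
    witnesses. The face-cycle is found by searching the orderings with the prescribed sizes. *)
Definition vertex_ok (ds : seq nat) (fk : seq keyed_face) (v : pt) : bool :=
  let k := vkey v in
  let A : seq keyed_face := [seq x : keyed_face <- fk | k \in x.1.2] in
  [&& uniq A,
      all (fun x : keyed_face => all (fun y : keyed_face =>
        (x == y) || has (fun w => vkey w \notin y.1.2) x.1.1) A) A &
      has (ring_ok k) [seq s : seq keyed_face <- permutations A |
        map (fun x : keyed_face => size x.1.1) s == ds]].

Definition semi_equivelar_ok (t : seq (nat * nat)) : bool :=
  let fk := map keyed Fs in wf_type t && all (vertex_ok (face_sizes t) fk) V.

Variable R : realType.
Hypothesis ok : polyhedral_ok N c M V E Fs.

Local Notation tor := (@tor R N c M).
Local Notation cell := (@cell R N c M).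
Local Notation tkey := (@tkey R N c M).
Local Notation tmap := (tile_map N c M V E Fs R).

Let N1 : 1 < N. Proof. by case/andP: ok. Qed.
Let M1 : 1 < M. Proof. by case/and3P: ok. Qed.
Let N0 : 0 < N. Proof. exact: lt_trans N1. Qed.
Let M0 : 0 < M. Proof. exact: lt_trans M1. Qed.

Lemma cell_vert v s : cell s (tor (ptR R v)) <-> vkey v \in s.
Proof.
by rewrite /cell /= (tkey_vkey R ok); split=> [[]|]; [|split; [exact: tor_torus|]].
Qed.

Lemma side_keys F e k : F \in Fs -> e \in sides F -> k \in ekeys e -> k \in fkeys F.
Proof.
move=> FF eF /mapP[a ae ->]; have [fok _ _ _] := faces_okP ok FF.
have /and5P[_ _ _ _ /and4P[_ _ _ /allP Lr]] := fok; apply/map_f/Lr.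
by apply/flattenP; exists (edge_labels e) => //; exact: map_f.
Qed.

Lemma vert_keys F v : F \in Fs -> v \in F -> vkey v \in fkeys F.
Proof.
move=> FF /(nthP (0, 0))[i iF <-].
pose e := (nth (0, 0) F i, nth (0, 0) F (i.+1 %% size F)%N).
apply: (@side_keys F e) => //; last by rewrite ekeys_mem eqxx.
by apply/mapP; exists i; rewrite // mem_iota.
Qed.

Lemma side_edge F e : F \in Fs -> e \in sides F -> edges tmap (cell (ekeys e)).
Proof.
move=> FF eF; have [_ _ /allP sF _] := faces_okP ok FF.
have /mapP[e' e'E /kset_mem ee'] := sF _ eF.
by exists e' => //; apply: (cell_mem N c M R) => k; rewrite -ee'.
Qed.

Lemma tile_map_semi_equivelar t : semi_equivelar_ok t -> semi_equivelar R tmap t.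
Proof.
move=> /andP[wf /allP vok]; split=> // u /(vertsP ok)[v vV ->].
have /and3P[uA /allP dA /hasP[s]] := vok v vV.
set A := [seq x <- _ | _] in uA dA *.
have AE x : x \in A -> [/\ x.1.1 \in Fs, x = keyed x.1.1 & vkey v \in x.1.2].
  by rewrite mem_filter => /andP[vx /mapP[F FF E1]]; rewrite E1 in vx *.
rewrite mem_filter mem_permutations => /andP[/eqP sd sA] /allP rs.
have us : uniq s by rewrite (perm_uniq sA).
have sz : size (face_sizes t) = size s by rewrite -sd size_map.
pose x0 : keyed_face := ([::], [::], [::]).
have inA i : (i < size s)%N -> nth x0 s i \in A.
  by move=> si; rewrite -(perm_mem sA) mem_nth.
exists (fun i => cell (nth x0 s i).1.2); rewrite sz; split; first split.
- split=> [i /= /inA/AE[FF -> vF]|i j /set_mem iF /set_mem jF ij|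
    _ [[F /= FF <-] /cell_vert vF]].
  + by split; [exists (nth x0 s i).1.1|exact/cell_vert].
  + apply/eqP; rewrite -(nth_uniq x0 iF jF us).
    (* If two different faces gave the same cell, a vertex of one missing from the other would lie
       in both. *)
    have /allP/(_ _ (inA _ jF))/orP[//|/hasP[w wi]] := dA _ (inA _ iF).
    move=> /negP[]; apply/cell_vert; rewrite -ij; apply/cell_vert.
    have [FF -> _] := AE _ (inA _ iF); exact: vert_keys.
  + have FA : keyed F \in s.
      by rewrite (perm_mem sA) mem_filter vF; exact: map_f.
    by exists (index (keyed F) s); rewrite /= ?index_mem ?nth_index.
- move=> i iF; have [FF FE _] := AE _ (inA _ iF).
  have /rs/hasP[e] : i \in iota 0 (size s) by rewrite mem_iota.
  rewrite -/x0 {1}FE => /mapP[d dF ->] /andP[ve /allP eG].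
  exists (cell (ekeys d)); first exact: side_edge dF.
  split; first exact/cell_vert.
  move=> t' [tt te]; split; split=> //; last exact: eG.
  by rewrite FE; exact: side_keys dF te.
- move=> i iF; have [FF FE _] := AE _ (inA _ iF).
  by rewrite -sd (nth_map x0) // FE; exact: face_ngon.
Qed.
End Vertices.

(** * Automorphisms and vertex orbits *)

Section Automorphism.
Variables (T : Type) (K : cells T).

Definition traces (A : set (set T)) : set (set T) := [set X `&` verts K | X in A].

Definition vertex_orbit (u : T) : set T := [set phi u | phi in automorphism K].

Lemma automorphism_comp phi psi :
  automorphism K phi -> automorphism K psi -> automorphism K (psi \o phi).
Proof.
move=> [phb phe phf] [psb pse psf].
have sub A : A `<=` verts K -> phi @` A `<=` verts K.
  by move=> AV _ [x /AV Vx <-]; case: phb => + _ _; apply.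
split.
- exact: set_bij_comp phb psb.
- move=> A AV; rewrite -image_comp; apply: iff_trans (phe A AV) _.
  exact/pse/sub.
- move=> A AV; rewrite -image_comp; apply: iff_trans (phf A AV) _.
  exact/psf/sub.
Qed.

Lemma vertex_orbit_image phi u :
  automorphism K phi -> vertex_orbit (phi u) `<=` vertex_orbit u.
Proof.
by move=> ph _ [psi ps <-]; exists (psi \o phi) => //; exact: automorphism_comp.
Qed.

Definition face_traces (k : nat) : set (set T) :=
  [set A | traces (faces K) A /\ (A #= `I_k)%card].

(** The choice [A = B] is allowed, so for equal sizes the vertex sets of whole faces are blocks as
    well. *)
Definition blocks (kl : nat * nat) : set (set T) :=
  [set A `&` B | A in face_traces kl.1 & B in face_traces kl.2].

Definition spread (W : set T) (kl : nat * nat) : set T :=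
  \bigcup_(A in [set A | blocks kl A /\ A `&` W !=set0]) A.

Definition walk (w : seq (nat * nat)) (W : set T) : set T := foldl spread W w.

Lemma spread_sub W kl : spread W kl `<=` verts K.
Proof. by move=> t [A [[_ [[F FF <-] _] [B _ <-]] _] [[]]]. Qed.

(** Walks are built from the vertex sets of faces and their sizes alone. An automorphism permutes
    these sets, and being injective on vertices it preserves sizes and intersections. *)
Lemma walk_image phi w W : automorphism K phi -> W `<=` verts K ->
  walk w (phi @` W) = phi @` walk w W.
Proof.
move=> [[pf pinj psurj] _ phf].
have inj (x y : T) : verts K x -> verts K y -> phi x = phi y -> x = y.
  by move=> Vx Vy; apply: pinj; exact: mem_set.
have tr k A : A `<=` verts K -> face_traces k A <-> face_traces k (phi @` A).
  move=> AV; have := propext (phf A AV); rewrite /face_traces /traces /= => ->.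
  have -> // : (phi @` A #= `I_k)%card = (A #= `I_k)%card.
  apply: card_eql; apply: inj_card_eq => x y /set_mem/AV Vx /set_mem/AV Vy.
  exact: inj.
have trV k A : face_traces k A -> A `<=` verts K by move=> [[F _ <-] _] x [].
(* Every set of vertices is an image, so blocks on the image side can be pulled back. *)
have pre A : A `<=` verts K -> exists2 B, B `<=` verts K & A = phi @` B.
  move=> AV; exists (verts K `&` phi @^-1` A) => [x []//|].
  apply/seteqP; split=> [x Ax|_ [x [Vx Ax] <-]//].
  by have [y Vy yx] := psurj x (AV x Ax); exists y => //; split=> //=; rewrite yx.
have imI A B : A `<=` verts K -> B `<=` verts K ->
    phi @` A `&` phi @` B = phi @` (A `&` B).
  move=> AV BV; apply/seteqP; split=> [_ [[x Ax <-] [y By yx]]|_ [x [Ax Bx] <-]].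
    by exists x => //; split=> //; rewrite (inj x y) //; [exact: AV|exact: BV].
  by split; exists x.
have blocks_phi kl A : A `<=` verts K -> blocks kl (phi @` A) <-> blocks kl A.
  move=> AV; split=> [[B B1 [D D1 BDA]]|[B B1 [D D1 <-]]]; last first.
    exists (phi @` B); first exact: (iffLR (tr _ _ (trV _ _ B1)) B1).
    exists (phi @` D); first exact: (iffLR (tr _ _ (trV _ _ D1)) D1).
    by apply: imI; [exact: trV B1|exact: trV D1].
  have [B' B'V EB] := pre _ (trV _ _ B1); have [D' D'V ED] := pre _ (trV _ _ D1).
  rewrite {}EB {}ED in B1 D1 BDA.
  exists B'; first exact: (iffRL (tr _ _ B'V) B1).
  exists D'; first exact: (iffRL (tr _ _ D'V) D1).
  rewrite imI // in BDA; apply/seteqP; split=> x xA.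
    have : (phi @` A) (phi x) by rewrite -BDA; exists x.
    by move=> [y Ay /inj <-] //; [exact: AV|case: xA => /B'V].
  have : (phi @` (B' `&` D')) (phi x) by rewrite BDA; exists x.
  by move=> [y [B'y D'y] /inj <-] //; [exact: B'V|exact: AV].
have blV kl A : blocks kl A -> A `<=` verts K.
  by move=> [B /trV BV [D _ <-]] x [/BV].
have sp W' kl : W' `<=` verts K -> spread (phi @` W') kl = phi @` spread W' kl.
  move=> WV; apply/seteqP; split.
    move=> t [A [Ab [x [Ax [y Wy yx]]]] At].
    have [B BV EA] := pre _ (blV _ _ Ab); rewrite {}EA in Ab Ax At.
    have [z Bz zt] := At; exists z => //; exists B => //; split.
      exact: (iffLR (blocks_phi _ _ BV) Ab).
    have [y' By' y'x] := Ax; exists y; split=> //.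
    by rewrite -(inj y' y) //; [exact: BV|exact: WV|rewrite y'x].
  move=> _ [t [A [Ab [x [Ax Wx]]] At] <-].
  exists (phi @` A); last by exists t.
  split; first exact: (iffRL (blocks_phi _ _ (blV _ _ Ab)) Ab).
  by exists (phi x); split; exists x.
elim: w W => //= kl w IH W WV; rewrite sp // IH //.
exact: spread_sub.
Qed.

End Automorphism.

(* [(false, a)] is the translation by [a] and [(true, a)] the point reflection
   [v |-> a - v]. *)
Local Notation sym := (bool * pt)%type.

Definition sact (s : sym) (v : pt) : pt :=
  if s.1 then (s.2.1 - v.1, s.2.2 - v.2) else (s.2.1 + v.1, s.2.2 + v.2).

Definition sinv (s : sym) : sym := if s.1 then s else (false, (- s.2.1, - s.2.2)).

(** * Symmetries of the tilings and computable orbit invariants *)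

Section Symmetry.
Variables (N c M : int) (V : seq pt) (E : seq (pt * pt)) (Fs : seq (seq pt)).

Local Notation key := (key N c M).
Local Notation vkey := (vkey N c M).
Local Notation ekeys := (ekeys N c M).
Local Notation fkeys := (fkeys N c M).

Definition vset (l : seq pt) : seq BinNums.N := kset (map vkey l).

Definition edge_ends : seq (seq pt) := [seq [:: e.1; e.2] | e <- E].

(** Only inclusions are tested; the same test for [sinv s] supplies the converse. *)
Definition sym_ok (s : sym) : bool :=
  let vk := map vkey V in
  all (fun v => vkey (sact s v) \in vk) V &&
  all (fun L => let k := map vset L in all (fun l => vset (map (sact s) l) \in k) L)
    [:: edge_ends; Fs].

(** A lattice point inside a hull, such as the center of a hexagon, must not be a vertex of the map;
    then a face has exactly its listed vertices. *)
Definition face_verts_ok : bool :=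
  let vk := map vkey V in
  all (fun F => let f := map vkey F in
    all (fun k => (k \in vk) ==> (k \in f)) (fkeys F)) Fs.

(** Translations are normal in the group that they generate with a point reflection, so at most one
    [s'] followed by powers of [s] reaches a whole orbit. *)
Definition transitive_ok (s s' : sym) (n : nat) (reps : seq pt) : bool :=
  let vk := map vkey V in
  let orb := [seq vkey (iter i (sact s) w) | i <- iota 0 n,
                                            w <- reps ++ map (sact s') reps] in
  [&& all (fun r => vkey r \in vk) reps, all (mem orb) vk &
      [&& sym_ok s, sym_ok (sinv s), sym_ok s' & sym_ok (sinv s')]].

Definition kblocks (kl : nat * nat) : seq (seq BinNums.N) :=
  let fk := [seq (size F, map vkey F) | F <- Fs] in
  [seq [seq k <- s | k \in s'] | s <- [seq x.2 | x <- fk & x.1 == kl.1],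
                                 s' <- [seq x.2 | x <- fk & x.1 == kl.2]].

Definition kspread (W : seq BinNums.N) (B : seq (seq BinNums.N)) : seq BinNums.N :=
  undup (flatten [seq b <- B | has (mem W) b]).

Definition kwalk (w : seq (nat * nat)) (r : pt) : seq BinNums.N :=
  foldl kspread [:: vkey r] (map kblocks w).

(** The invariant of a vertex is the list of its walk sizes, one for each word in [ws]. *)
Definition distinct_ok (ws : seq (seq (nat * nat))) (reps : seq pt) : bool :=
  let bs := [seq map kblocks w | w <- ws] in
  uniq [seq [seq size (foldl kspread [:: vkey r] b) | b <- bs] | r <- reps].

Definition orbits_ok s s' n ws reps : bool :=
  [&& face_verts_ok, transitive_ok s s' n reps & distinct_ok ws reps].

Variable R : realType.
Hypothesis ok : polyhedral_ok N c M V E Fs.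

Local Notation tor := (@tor R N c M).
Local Notation cell := (@cell R N c M).
Local Notation tkey := (@tkey R N c M).
Local Notation tmap := (tile_map N c M V E Fs R).

Let N1 : 1 < N. Proof. by case/andP: ok. Qed.
Let M1 : 1 < M. Proof. by case/and3P: ok. Qed.
Let N0 : 0 < N. Proof. exact: lt_trans N1. Qed.
Let M0 : 0 < M. Proof. exact: lt_trans M1. Qed.

Definition sactR (s : sym) (p : R * R) : R * R :=
  if s.1 then (s.2.1%:~R - p.1, s.2.2%:~R - p.2)
  else (s.2.1%:~R + p.1, s.2.2%:~R + p.2).

Lemma sactR_pt s v : sactR s (ptR R v) = ptR R (sact s v).
Proof. by case: s => [[] a]; rewrite /sactR /ptR /= ?intrB ?intrD. Qed.

Definition torus_act (s : sym) (t : (R * R) * (R * R)) : (R * R) * (R * R) :=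
  tor (sactR s (xget (0, 0) [set p | tor p = t])).

(** The chosen preimage does not matter: a translation commutes with periods and a point reflection
    turns a period into its opposite. *)
Lemma tact_tor s p : torus_act s (tor p) = tor (sactR s p).
Proof.
rewrite /torus_act; case: xgetP => [q _ /= /(tor_eq c N0 M0)[k [l ->]]|/(_ p)[]//].
apply/(tor_eq c N0 M0); case: s => [[] a].
  exists (- k), (- l); rewrite /sactR /lattice_trans /= !mulrN !(intrD, intrN).
  by congr pair; ring.
by exists k, l; rewrite /sactR /lattice_trans /=; congr pair; ring.
Qed.

Lemma tact_pt s v : torus_act s (tor (ptR R v)) = tor (ptR R (sact s v)).
Proof. by rewrite tact_tor sactR_pt. Qed.

Lemma sactRK s : cancel (sactR s) (sactR (sinv s)).
Proof.
case: s => [[] a] [x y]; rewrite /sactR /sinv /= ?intrN; congr pair; ring.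
Qed.

Lemma sinvK : involutive sinv.
Proof. by case=> [[] [a b]] //=; rewrite /sinv /= !opprK. Qed.

Lemma tactK s t : torus R t -> torus_act (sinv s) (torus_act s t) = t.
Proof. by move=> /(tor_surj c N0 M0)[p <-]; rewrite !tact_tor sactRK. Qed.

Definition vcell (l : seq pt) : set ((R * R) * (R * R)) := cell (map vkey l).

Lemma vcellP l t : vcell l t <-> exists2 v, v \in l & t = tor (ptR R v).
Proof.
split=> [[tt /mapP[v vl /(tkey_vkey_eq ok _ tt)]]|[v vl ->]]; first by exists v.
by apply/(cell_vert R ok)/map_f.
Qed.

Lemma tact_vcell s l : torus_act s @` vcell l = vcell (map (sact s) l).
Proof.
apply/seteqP; split=> [_ [t /vcellP[v vl ->] <-]|t /vcellP[_ /mapP[v vl ->] ->]].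
  by apply/vcellP; exists (sact s v); [exact: map_f|exact: tact_pt].
exists (tor (ptR R v)); last exact: tact_pt.
by apply/vcellP; exists v.
Qed.

Lemma vset_vcell l l' : vset l = vset l' -> vcell l = vcell l'.
Proof. by move=> /kset_mem; exact: cell_mem. Qed.

Definition vcells (L : seq (seq pt)) := [set vcell l | l in [set` L]].

Lemma edge_traces : traces tmap (edges tmap) = vcells edge_ends.
Proof.
have E2 e : e \in E -> cell (ekeys e) `&` verts tmap = vcell [:: e.1; e.2].
  move=> eE; rewrite (edge_verts R ok) //; apply/seteqP; split=> t.
    by case=> ->; apply/vcellP; [exists e.1|exists e.2]; rewrite // !inE eqxx ?orbT.
  move=> /vcellP[v]; rewrite !inE => /orP[] /eqP-> ->; by [left|right].
apply/seteqP; split=> [_ [_ [e eE <-] <-]|_ [_ /mapP[e eE ->] <-]].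
  by rewrite E2 //; exists [:: e.1; e.2] => //; exact: (map_f (fun e => [:: e.1; e.2])).
by rewrite -E2 //; exists (cell (ekeys e)) => //; exists e.
Qed.

Hypothesis fvok : face_verts_ok.

Lemma face_verts F : F \in Fs -> cell (fkeys F) `&` verts tmap = vcell F.
Proof.
move=> FF; have /allP/(_ F FF)/allP fF := fvok.
apply/seteqP; split=> [t [[tt tF] [_ tV]]|t /vcellP[v vF ->]].
  by split=> //; exact: (implyP (fF _ tF)).
split; first by apply/(cell_vert R ok); exact: vert_keys ok _ _ FF vF.
have [_ /allP vV _ _] := faces_okP ok FF.
by apply: (mem_verts R ok); exact: vV.
Qed.

Lemma face_tracesE : traces tmap (faces tmap) = vcells Fs.
Proof.
apply/seteqP; split=> [_ [_ [F FF <-] <-]|_ [F FF <-]].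
  by rewrite face_verts //; exists F.
by exists (cell (fkeys F)); [exists F|exact: face_verts].
Qed.

Lemma vcells_tact s L A : all (fun l => vset (map (sact s) l) \in map vset L) L ->
  vcells L A -> vcells L (torus_act s @` A).
Proof.
move=> /allP sL [l lL <-]; have /mapP[l' l'L /vset_vcell ll'] := sL _ lL.
by rewrite tact_vcell ll'; exists l'.
Qed.

Lemma tact_automorphism s : sym_ok s -> sym_ok (sinv s) ->
  automorphism tmap (torus_act s).
Proof.
move=> /andP[/allP sV /and3P[sE sF _]] /andP[/allP iV /and3P[iE iF _]].
have VT A : A `<=` verts tmap -> torus_act (sinv s) @` (torus_act s @` A) = A.
  move=> AV; rewrite image_comp; apply/seteqP; split=> [_ [t At <-]|t At].
    by rewrite /= tactK //; case: (AV t At).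
  by exists t => //=; rewrite tactK //; case: (AV t At).
have pV s' : (forall v, v \in V -> vkey (sact s' v) \in map vkey V) ->
    forall t, verts tmap t -> verts tmap (torus_act s' t).
  move=> s'V t /(vertsP ok)[v vV ->]; rewrite tact_pt.
  by apply: (mem_verts R ok); exact: s'V.
split.
- split=> [t|t u /set_mem [tt _] /set_mem [tu _] stu|t Vt]; first exact: pV.
    by rewrite -(tactK s tt) stu tactK.
  exists (torus_act (sinv s) t); first exact: pV Vt.
  by have [tt _] := Vt; rewrite -{1}[s]sinvK tactK.
- move=> A AV; rewrite -/(traces _ _) edge_traces; split; first exact: vcells_tact.
  by rewrite -{2}(VT A AV); exact: vcells_tact.
- move=> A AV; rewrite -/(traces _ _) face_tracesE; split; first exact: vcells_tact.
  by rewrite -{2}(VT A AV); exact: vcells_tact.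
Qed.

Lemma orbit_tact s v : sym_ok s -> sym_ok (sinv s) ->
  vertex_orbit tmap (tor (ptR R (sact s v))) = vertex_orbit tmap (tor (ptR R v)).
Proof.
move=> sok iok; rewrite -tact_pt; apply/seteqP; split.
  by apply: vertex_orbit_image; exact: tact_automorphism.
rewrite -{1}(tactK s (tor_torus _ _ _ (ptR R v))).
by apply: vertex_orbit_image; apply: tact_automorphism; rewrite ?sinvK.
Qed.

Lemma card_cell (s : seq BinNums.N) : uniq s -> {subset s <= map vkey V} ->
  (cell s #= `I_(size s))%card.
Proof.
move=> us sV.
pose f i := tor (ptR R (nth (0, 0) V (index (nth BinNums.N0 s i) (map vkey V)))).
have fk i : (i < size s)%N -> tkey (f i) = nth BinNums.N0 s i.
  move=> si; rewrite (tkey_vkey R ok) -(nth_map _ BinNums.N0); last first.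
    by rewrite -(size_map vkey) index_mem sV ?mem_nth.
  by rewrite nth_index // sV ?mem_nth.
rewrite card_eq_sym; apply/card_set_bijP; exists f; split.
- by move=> i si; split; [exact: tor_torus|rewrite fk ?mem_nth].
- move=> i j /set_mem si /set_mem sj fij; apply/eqP.
  by rewrite -(nth_uniq BinNums.N0 si sj us); have := fk i si; rewrite fij fk // => ->.
- move=> t [tt ts]; exists (index (tkey t) s); first by rewrite /= index_mem.
  have /mapP[v vV tv] := sV _ ts.
  have fi : tkey (f (index (tkey t) s)) = tkey t by rewrite fk ?index_mem ?nth_index.
  transitivity (tor (ptR R v)); last exact/esym/(tkey_vkey_eq ok).
  by apply/(tkey_vkey_eq ok); [exact: tor_torus|rewrite fi].
Qed.

Lemma face_vkeys F : F \in Fs ->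
  uniq (map vkey F) /\ {subset map vkey F <= map vkey V}.
Proof.
move=> FF; have [/and5P[_ uF _ _ _] /allP vV _ _] := faces_okP ok FF.
by split=> // _ /mapP[v vF ->]; exact: vV.
Qed.

(** The listed vertices of a face have distinct keys, so the cardinality of its vertex set is the
    length of the list. *)
Lemma face_tracesP k A : face_traces tmap k A <->
  exists2 F, F \in Fs & size F = k /\ A = vcell F.
Proof.
have cardF F : F \in Fs -> (vcell F #= `I_(size F))%card.
  by move=> /face_vkeys[uF FV]; rewrite -(size_map vkey); exact: card_cell.
rewrite /face_traces /= face_tracesE; split=> [[[F FF <-] Fk]|[F FF [<- ->]]].
  exists F => //; split=> //; apply/card_eq_II.
  by apply: card_eq_trans Fk; rewrite card_eq_sym; exact: cardF.
by split; [exists F|exact: cardF].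
Qed.

Lemma kblocks_sub kl b : b \in kblocks kl -> {subset b <= map vkey V}.
Proof.
move=> /allpairsP[[s s'] /= [/mapP[x xs ->] _ ->]] k.
move: xs; rewrite !mem_filter => /andP[_ /mapP[F FF ->]] /andP[_].
by apply: (face_vkeys FF).2.
Qed.

Lemma blocksP kl A : blocks tmap kl A <-> exists2 b, b \in kblocks kl & A = cell b.
Proof.
have mem k s :
    s \in [seq x.2 | x <- [seq (size F, map vkey F) | F <- Fs] & x.1 == k] <->
    exists2 F, F \in Fs & size F = k /\ s = map vkey F.
  split=> [/mapP[x]|[F FF [Fk ->]]].
    by rewrite mem_filter => /andP[/eqP xk /mapP[F FF xE]] ->; exists F => //;
      rewrite -xk xE.
  apply/mapP; exists (k, map vkey F) => //.
  by rewrite mem_filter /= eqxx -Fk; exact: (map_f (fun F => (size F, map vkey F)) FF).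
have capE s s' : cell s `&` cell s' = cell [seq k <- s | k \in s'].
  apply/seteqP; split=> [t [[tt ts] [_ ts']]|t [tt]].
    by split=> //; rewrite mem_filter ts'.
  by rewrite mem_filter => /andP[? ?].
split=> [[A1 /face_tracesP[F FF [Fk ->]] [A2 /face_tracesP[G GG [Gl ->]] <-]]|].
  exists [seq k <- map vkey F | k \in map vkey G]; last exact: capE.
  by apply/allpairsP; exists (map vkey F, map vkey G); split=> //;
    apply/mem; [exists F|exists G].
move=> [_ /allpairsP[[s s'] /= [/mem[F FF [Fk ->]] /mem[G GG [Gl ->]] ->]] ->].
exists (vcell F); first by apply/face_tracesP; exists F.
exists (vcell G); first by apply/face_tracesP; exists G.
exact: capE.
Qed.

Lemma kspread_sub W kl : {subset kspread W (kblocks kl) <= map vkey V}.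
Proof.
move=> k; rewrite mem_undup => /flattenP[b]; rewrite mem_filter => /andP[_ bk].
exact: kblocks_sub bk k.
Qed.

Lemma spread_cell W kl : {subset W <= map vkey V} ->
  spread tmap (cell W) kl = cell (kspread W (kblocks kl)).
Proof.
move=> WV; apply/seteqP; split.
  move=> t [A [/blocksP[b bk ->] [u [[_ ub] [_ uW]]]] [tt tb]].
  split=> //; rewrite mem_undup; apply/flattenP; exists b => //.
  by rewrite mem_filter bk andbT; apply/hasP; exists (tkey u).
move=> t [tt]; rewrite mem_undup => /flattenP[b].
rewrite mem_filter => /andP[/hasP[k kb kW] bk] tb.
(* A common key must come from an actual point; since [W] consists of vertex keys, a vertex provides
   it. *)
have /mapP[v vV kE] := WV _ kW; rewrite /= kE in kb kW.
exists (cell b) => //; split; first by apply/blocksP; exists b.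
by exists (tor (ptR R v)); split; apply/(cell_vert R ok).
Qed.

Lemma walk_cell w r : vkey r \in map vkey V ->
  [/\ uniq (kwalk w r), {subset kwalk w r <= map vkey V} &
      walk tmap w [set tor (ptR R r)] = cell (kwalk w r)].
Proof.
move=> rV; have -> : [set tor (ptR R r)] = cell [:: vkey r].
  apply/seteqP; split=> [t ->|t [tt]]; first by apply/(cell_vert R ok); rewrite inE.
  by rewrite inE => /eqP /(tkey_vkey_eq ok _ tt).
have : uniq [:: vkey r] by [].
have : {subset [:: vkey r] <= map vkey V} by move=> k; rewrite inE => /eqP->.
rewrite /kwalk; move: [:: vkey r]; elim: w => [|kl w IH] W WV uW /=; first by [].
rewrite spread_cell //; apply: IH; [exact: kspread_sub|exact: undup_uniq].
Qed.

(** By [walk_image] the walk from [r] is carried onto the walk from [r'], and [phi] is injective on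
    vertices. *)
Lemma walk_size phi w r r' : automorphism tmap phi ->
  vkey r \in map vkey V -> vkey r' \in map vkey V ->
  phi (tor (ptR R r)) = tor (ptR R r') -> size (kwalk w r) = size (kwalk w r').
Proof.
move=> aphi rV r'V phir; have [u sV wE] := walk_cell w rV.
have [u' sV' wE'] := walk_cell w r'V.
have im : walk tmap w [set tor (ptR R r')] = phi @` walk tmap w [set tor (ptR R r)].
  by rewrite -phir -image_set1 walk_image // => t ->; exact: (mem_verts R ok).
rewrite wE wE' in im; apply/card_eq_II.
apply: card_eq_trans (card_cell u' sV'); rewrite im.
apply: card_eq_trans (_ : (cell (kwalk w r) #= _)%card).
  by rewrite card_eq_sym; exact: card_cell.
rewrite card_eq_sym; apply: inj_card_eq => x y /set_mem [xt xw] /set_mem [yt yw].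
by have [[_ pinj _] _ _] := aphi; apply: pinj; apply: mem_set; split=> //; exact: sV.
Qed.

(** The representatives index the orbits: [transitive_ok] makes the indexing onto, and the walk
    sizes, constant on orbits and distinct by [distinct_ok], make it injective. *)
Lemma tile_map_orbits s s' n ws reps :
  transitive_ok s s' n reps -> distinct_ok ws reps ->
  (vertex_orbits tmap #= `I_(size reps))%card.
Proof.
move=> /and3P[/allP rV /allP tr /and4P[s1 s2 s3 s4]] dis.
rewrite card_eq_sym; apply/card_set_bijP.
pose f i := vertex_orbit tmap (tor (ptR R (nth (0, 0) reps i))); exists f.
have id_aut : automorphism tmap id.
  by split=> [|A _|A _]; rewrite ?image_id //; split=> // t Vt; exists t.
split.
- move=> i /= ir; exists (tor (ptR R (nth (0, 0) reps i))) => //.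
  by apply: (mem_verts R ok); apply: rV; exact: mem_nth.
- move=> i j /set_mem ir /set_mem jr fij.
  have [phi aphi phir] : f i (tor (ptR R (nth (0, 0) reps j))).
    by rewrite fij; exists id.
  apply/eqP; rewrite -(nth_uniq [::] _ _ dis) ?size_map //.
  rewrite !(nth_map (0, 0)) // -!map_comp; apply/eqP/eq_map => w.
  by apply: (walk_size w aphi _ _ phir); apply: rV; exact: mem_nth.
- move=> _ [_ /(vertsP ok)[v vV ->] <-].
  (* Here [w] is a representative or its image by [s'], and [v] is [w] moved by a power of [s];
     neither move leaves the orbit. *)
  have /allpairsP[[k w] /= [_ wr vE]] := tr _ (map_f vkey vV).
  have -> : tor (ptR R v) = tor (ptR R (iter k (sact s) w)).
    exact: (vkey_inj R ok vE).
  have -> : [set phi (tor (ptR R (iter k (sact s) w))) | phi in automorphism tmap] =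
      vertex_orbit tmap (tor (ptR R w)).
    by rewrite -/(vertex_orbit tmap _); elim: k {vE} => //= k <-; rewrite orbit_tact.
  have [r rr ->] : exists2 r, r \in reps &
      vertex_orbit tmap (tor (ptR R w)) = vertex_orbit tmap (tor (ptR R r)).
    move: wr; rewrite mem_cat => /orP[|/mapP[r rr ->]]; first by exists w.
    by exists r; rewrite ?orbit_tact.
  by exists (index r reps); rewrite /f /= ?index_mem ?nth_index.
Qed.

End Symmetry.

(** * The five maps *)

Definition translates (s : sym) (n : nat) (base : seq (seq pt)) : seq (seq pt) :=
  [seq map (iter i (sact s)) F | i <- iota 0 n, F <- base].

(** Neighbouring faces repeat vertices and edges, perhaps shifted by a period or reversed; one copy
    is kept for each key. *)
Definition dedup (T : Type) (f : T -> BinNums.N) (s : seq T) : seq T :=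
  unzip2 (foldr (fun x r => if x.1 \in unzip1 r then r else x :: r) [::]
    [seq (f x, x) | x <- s]).

Definition tile_ok N c M V E Fs t s s' n ws reps : bool :=
  [&& polyhedral_ok N c M V E Fs, semi_equivelar_ok N c M V Fs t &
      orbits_ok N c M V E Fs s s' n ws reps].

Lemma tile_map_exists N c M V E Fs t s s' n ws reps :
  tile_ok N c M V E Fs t s s' n ws reps ->
  forall R : realType, exists K : cells ((R * R) * (R * R))%type,
    [/\ polyhedral_map R (torus R) K, semi_equivelar R K t &
        (vertex_orbits K #= `I_(size reps))%card].
Proof.
move=> /and3P[pok sok /and3P[fv tr dis]] R; exists (tile_map N c M V E Fs R); split.
- exact: (tile_map_polyhedral R pok).
- exact: (tile_map_semi_equivelar R pok sok).
- exact: (tile_map_orbits R pok fv tr dis).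
Qed.

(** The reflection [(true, (0, 0))] is in the origin, where each tiling below has the center of a
    hexagon or dodecagon. *)
Definition tiling_ok (N c M : int) (a : pt) (n : nat) (base : seq (seq pt))
    (t : seq (nat * nat)) (ws : seq (seq (nat * nat))) (reps : seq pt) : bool :=
  let Fs := translates (false, a) n base in
  let E := dedup (fun e => key N c M (elab e)) (flatten (map sides Fs)) in
  let V := dedup (vkey N c M) (flatten Fs) in
  tile_ok N c M V E Fs t (false, a) (true, (0, 0)) n ws reps.

Lemma tiling_exists (N c M : int) a n base t ws reps :
  tiling_ok N c M a n base t ws reps ->
  forall R : realType, exists K : cells ((R * R) * (R * R))%type,
    [/\ polyhedral_map R (torus R) K, semi_equivelar R K t &
        (vertex_orbits K #= `I_(size reps))%card].
Proof. exact: (@tile_map_exists N c M _ _ (translates (false, a) n base)). Qed.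

Definition hexagon (c : pt) : seq pt :=
  [seq (c.1 + v.1, c.2 + v.2) |
    v <- [:: (1, 0); (1, 1); (0, 1); (-1, 0); (-1, -1); (0, -1)]].

(** A hexagon of side 2 whose side midpoints are flat vertices. *)
Definition dodecagon : seq pt :=
  [:: (2, 0); (2, 1); (2, 2); (1, 2); (0, 2); (-1, 1);
      (-2, 0); (-2, -1); (-2, -2); (-1, -2); (0, -2); (1, -1)].

Definition lower_triangle (v : pt) : seq pt :=
  [:: v; (v.1 + 1, v.2); (v.1 + 1, v.2 + 1)].
Definition upper_triangle (v : pt) : seq pt :=
  [:: v; (v.1 + 1, v.2 + 1); (v.1, v.2 + 1)].

(* In each case [a] generates the translations of the tiling modulo the periods,
   and [n] is its order. *)
Lemma trihexagonal_ok : tiling_ok 10 6 4 (0, 2) 10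
  [:: hexagon (0, 0); lower_triangle (0, 1); upper_triangle (1, 0)]
  [:: (3, 1); (6, 1); (3, 1); (6, 1)]%N [:: [:: (3, 3); (3, 3); (3, 3)]]%N
  [:: (0, 1); (1, 0); (1, 1)].
Proof. by vm_compute. Qed.

(** Each vertex lies on one hexagon, and the reflection pairs the six vertices of the hexagon at the
    origin, leaving three classes. *)
Lemma snub_hexagonal_ok : tiling_ok 14 11 5 (-2, 1) 10
  [:: hexagon (0, 0); lower_triangle (1, 0); upper_triangle (1, 0);
      lower_triangle (2, 0); upper_triangle (2, 0); lower_triangle (3, 0);
      upper_triangle (3, 0); lower_triangle (5, 0); upper_triangle (6, 0)]
  [:: (3, 4); (6, 1)]%N [:: [:: (3, 3); (3, 3); (6, 6); (3, 3)]]%N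
  [:: (0, 1); (0, 2); (0, 3)].
Proof. by vm_compute. Qed.

(** The squares are drawn as unit rhombi, each made of two lattice triangles. *)
Lemma rhombitrihexagonal_ok : tiling_ok 14 8 5 (3, 1) 10
  [:: hexagon (0, 0); [:: (1, 0); (2, 0); (2, 1); (1, 1)];
      [:: (1, 1); (2, 2); (1, 2); (0, 1)]; [:: (0, 1); (0, 2); (-1, 1); (-1, 0)];
      upper_triangle (1, -1); lower_triangle (1, 1)]
  [:: (3, 1); (4, 1); (6, 1); (4, 1)]%N [:: [:: (4, 4); (4, 4); (4, 4)]]%N
  [:: (0, 1); (0, 2); (0, 3)].
Proof. by vm_compute. Qed.

(** Each vertex lies on one triangle, and the reflection exchanges the two translation classes of
    triangles, leaving three classes of vertices. *)
Lemma truncated_hexagonal_ok : tiling_ok 13 5 11 (4, 1) 11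
  [:: dodecagon; lower_triangle (5, 0); upper_triangle (11, 0)]
  [:: (3, 1); (12, 2)]%N [:: [:: (12, 12); (12, 12)]]%N
  [:: (0, 2); (0, 5); (0, 6)].
Proof. by vm_compute. Qed.

(** Each vertex lies on one dodecagon, whose twelve vertices the reflection pairs. The six classes
    are separated by the pairs of walk sizes for the two words. *)
Lemma truncated_trihexagonal_ok : tiling_ok 21 13 11 (5, 1) 11
  [:: dodecagon; [:: (2, 0); (3, 0); (3, 1); (2, 1)];
      [:: (2, 2); (3, 3); (2, 3); (1, 2)]; [:: (0, 2); (0, 3); (-1, 2); (-1, 1)];
      hexagon (3, 2); hexagon (1, 3)]
  [:: (4, 1); (6, 1); (12, 1)]%N
  [:: [:: (4, 4); (12, 12); (4, 4); (12, 12)];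
      [:: (12, 6); (4, 4); (6, 6); (12, 12); (4, 4)]]%N
  [:: (0, 2); (0, 3); (0, 6); (0, 8); (0, 9); (0, 10)].
Proof. by vm_compute. Qed.

Local Close Scope ring_scope.

Theorem theorem1p8 (R : realType) :
  (forall t : seq (nat * nat),
     t \in [:: [:: (3, 1); (6, 1); (3, 1); (6, 1)];
               [:: (3, 4); (6, 1)];
               [:: (3, 1); (4, 1); (6, 1); (4, 1)];
               [:: (3, 1); (12, 2)]]%N ->
     exists M : cells ((R * R) * (R * R))%type,
       [/\ polyhedral_map R (torus R) M,
           semi_equivelar R M t &
           (vertex_orbits M #= `I_3)%card]) /\
  (exists N : cells ((R * R) * (R * R))%type,
     [/\ polyhedral_map R (torus R) N,
         semi_equivelar R N [:: (4, 1); (6, 1); (12, 1)]%N &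
         (vertex_orbits N #= `I_6)%card]).
Proof.
split; last exact: (tiling_exists truncated_trihexagonal_ok R).
move=> t; rewrite !inE => /or4P[] /eqP->.
- exact: (tiling_exists trihexagonal_ok R).
- exact: (tiling_exists snub_hexagonal_ok R).
- exact: (tiling_exists rhombitrihexagonal_ok R).
- exact: (tiling_exists truncated_hexagonal_ok R).
Qed.
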